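(* Let $N\ge 2$, $\beta=0$, $\alpha,\gamma,\mu>0$ and $T\in(0,\infty]$, and let $F$ be a symmetric equilibrium arrival distribution of the $(N+1)$-customer game with closing time $T$. If arrivals before time zero are allowed (early birds), then the equilibrium arrival distribution before time zero is uniform with density $$f(t)=\frac{\alpha\mu}{N(\alpha+\gamma\mu)},\qquad t\in[t_a,0],$$ where $t_a<0$ is the lower end of the support of $F$. Both when early birds are allowed and when they are not, after time zero the equilibrium arrival distribution is characterized by the functional differential equation $$f(t)=\frac{\alpha\left(1-\mathbb{P}(Q(t)=0)\right)}{N\left(\frac{\alpha}{\mu}+\gamma\right)},\qquad t\in[t_e,T),$$ where $t_e=0$ if early birds are allowed.
   Context: Model. There are $N+1$ customers, each choosing (possibly at random, independently) an arrival time. A single server starts operating at time $0$ and serves First Come First Served; service times are i.i.d. exponential with rate $\mu$. No arrivals are possible after the closing time $T$ ($T=\infty$ means no closing time), but all customers who arrived by time $T$ are served. If early birds are allowed, all $t\le T$ are admissible arrival times; otherwise only $0\le t\le T$. Customers arriving at exactly the same time are admitted in uniformly random order. Each customer pays $\alpha$ per unit of time from arrival until admission into service, and $\gamma$ for every customer ahead of him in the arrival order. When the other $N$ customers arrive independently according to a cdf $F$, the expected cost of arriving at $t$ is $$c_F(t)=-\alpha t\,\mathbf{1}_{\{t<0\}}+\frac{\alpha}{\mu}\mathbb{E}Q(t)+\gamma\,\mathbb{E}A(t),$$ where $A(t)$ is the number of the other customers that have arrived up to time $t$ and $Q(t)$ is the number of them present in the system (in queue or in service) at time $t$; if $F$ has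 an atom at $t$, then of the customers arriving exactly at $t$ only those placed ahead by the random tie-breaking are counted. The law of $Q(t)$, and in particular $\mathbb{P}(Q(t)=0)$, is determined by $F$ restricted to $(-\infty,t]$. A symmetric equilibrium arrival distribution is a cdf $F$ for which there is a constant $c_e$ such that $c_F(t)=c_e$ for all $t$ in the support of $F$ and $c_F(t)\ge c_e$ for every admissible $t$. Only distributions $F$ whose support is, on any finite interval, a finite union of closed intervals and points are considered. $f=F'$ denotes the density where $F$ is continuous and differentiable. If early birds are not allowed, the equilibrium has an atom of size $p_0>0$ at time $0$; if $p_0<1$ the rest of the support is an interval starting at some $t_e>0$ (and ending at $T$, or unbounded if $T=\infty$), i.e. there are no arrivals in $(0,t_e)$. The second formula concerns this remaining support, so in the case without early birds it presupposes $p_0<1$. *)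

(* Defs.v *)
From HB Require Import structures.
From mathcomp Require Import all_boot all_order all_algebra.
From mathcomp Require Import perm.
From mathcomp Require Import all_classical all_reals all_analysis.
Set Implicit Arguments.
Unset Strict Implicit.
Unset Printing Implicit Defensive.
Import Order.TTheory GRing.Theory Num.Theory.
Import numFieldNormedType.Exports.
Local Open Scope classical_set_scope.
Local Open Scope ring_scope.

(* A customer's key is (arrival time, tie-breaking rank); customers are
   admitted in the lexicographic order of their keys. *)
Definition before (R : realType) (m : nat) (p q : R * 'I_m) : bool :=
  (p.1 < q.1) || ((p.1 == q.1) && (p.2 < q.2)%N).

(* Departure times of the FCFS single server opening at time 0; see
   [departureE] for the recursion this computes.  The argument k is fuel: a
   customer with r predecessors needs k > r, so that k = n is always enough. *)
Fixpoint departure_rec (R : realType) (n m : nat) (key : 'I_n -> R * 'I_m)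
    (s : 'I_n -> R) (k : nat) (i : 'I_n) : R :=
  if k is k'.+1 then
    Num.max (key i).1
      (\big[Num.max/0]_(j < n | before (key j) (key i))
         departure_rec key s k' j) + s i
  else 0.

Definition departure (R : realType) (n m : nat) (key : 'I_n -> R * 'I_m)
    (s : 'I_n -> R) (i : 'I_n) : R :=
  departure_rec key s n i.

Lemma before_trans (R : realType) (m : nat) (q p r : R * 'I_m) :
  before p q -> before q r -> before p r.
Proof.
rewrite /before => /orP[pq|/andP[/eqP pq pq2]] /orP[qr|/andP[/eqP qr qr2]].
- by rewrite (lt_trans pq qr).
- by rewrite -qr pq.
- by rewrite pq qr.
- by rewrite pq qr eqxx (ltn_trans pq2 qr2) orbT.
Qed.

Lemma before_irr (R : realType) (m : nat) (p : R * 'I_m) : before p p = false.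
Proof. by rewrite /before ltxx ltnn andbF. Qed.

Lemma departure_rec_fuel (R : realType) (n m : nat) (key : 'I_n -> R * 'I_m)
    (s : 'I_n -> R) (k l : nat) (i : 'I_n) :
  (#|[pred j | before (key j) (key i)]| < k)%N ->
  (#|[pred j | before (key j) (key i)]| < l)%N ->
  departure_rec key s k i = departure_rec key s l i.
Proof.
elim: k l i => // k IH [//|l] i; rewrite !ltnS => ik il /=.
congr (Num.max _ _ + _); apply: eq_bigr => j ji.
have lt_ji : (#|[pred h | before (key h) (key j)]|
              < #|[pred h | before (key h) (key i)]|)%N.
  apply: proper_card; apply/properP; split.
    by apply/fintype.subsetP => h; rewrite !inE => hj; exact: before_trans hj ji.
  by exists j; rewrite !inE ?before_irr.
by apply: IH; [exact: leq_trans lt_ji ik|exact: leq_trans lt_ji il].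
Qed.

(* Service of i starts once i has arrived, the server has opened (time 0) and
   everybody ahead of i has left. *)
Lemma departureE (R : realType) (n m : nat) (key : 'I_n -> R * 'I_m)
    (s : 'I_n -> R) (i : 'I_n) :
  departure key s i =
  Num.max (key i).1
    (\big[Num.max/0]_(j < n | before (key j) (key i)) departure key s j) + s i.
Proof.
have lt_n j : (#|[pred h | before (key h) (key j)]| < n)%N.
  rewrite -[X in (_ < X)%N]card_ord; apply: proper_card; apply/properP.
  by split; [exact/fintype.subsetP|exists j; rewrite ?inE ?before_irr].
rewrite {1}/departure (@departure_rec_fuel _ _ _ _ _ _ n.+1)//=.
exact/leqW/lt_n.
Qed.

(* The N opponents of a tagged customer.  [tie w] ranks all N+1 customers: the
   opponent i has rank [tie w (lift ord_max i)] and the tagged one has rank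
   [tie w ord_max]; ranks only matter among customers with equal arrival
   times. *)
Record arrival_model (R : realType) (N : nat) (mu : R)
    (F : cumulativeBounded (0 : R) (1 : R)) (d : measure_display)
    (Omega : measurableType d) (P : probability Omega R) := ArrivalModel {
  arr : 'I_N -> {RV P >-> R} ;
  srv : 'I_N -> {RV P >-> R} ;
  tie : Omega -> 'S_N.+1 ;
  measurable_tie : forall s, measurable (tie @^-1` [set s]) ;
  arr_law : forall i t, cdf (arr i) t = (F t)%:E ;
  srv_law : forall i (B : set R), measurable B ->
    distribution P (srv i) B = exponential_prob mu B ;
  tie_law : forall s, P (tie @^-1` [set s]) = ((N.+1)`!%:R^-1)%:E ;
  model_indep : forall (A B : 'I_N -> set R) (s : 'S_N.+1),
    (forall i, measurable (A i)) -> (forall i, measurable (B i)) ->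
    P ([set w | forall i, A i (arr i w)] `&`
       [set w | forall i, B i (srv i w)] `&` (tie @^-1` [set s])) =
    ((\prod_(i < N) P (arr i @^-1` A i)) *
     (\prod_(i < N) P (srv i @^-1` B i)) * P (tie @^-1` [set s]))%E
}.

Section Queue.
Context (R : realType) (N : nat) (mu : R).
Context (F : cumulativeBounded (0 : R) (1 : R)).
Context (d : measure_display) (Omega : measurableType d).
Context (P : probability Omega R) (M : arrival_model N mu F P).
Implicit Types (t : R) (w : Omega) (i : 'I_N).

Definition key w i : R * 'I_N.+1 := (arr M i w, tie M w (lift ord_max i)).

Definition ahead t w i : bool := before (key w i) (t, tie M w ord_max).

Definition num_arrived t w : nat := #|[pred i | ahead t w i]|.

Definition num_present t w : nat :=
  #|[pred i | ahead t w i &&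
      (t < departure (key w) (fun j => srv M j w) i)]|.

Definition prob_empty t : R := fine (P [set w | num_present t w = 0%N]).

Definition cost (alpha gamma t : R) : R :=
  - alpha * t * (t < 0)%R%:R
  + alpha / mu * fine ('E_P[fun w => (num_present t w)%:R])%E
  + gamma * fine ('E_P[fun w => (num_arrived t w)%:R])%E.

End Queue.

Definition cdf_support (R : realType) (F : R -> R) : set R :=
  [set t | forall e, 0 < e -> F (t - e) < F (t + e)].

Definition admissible (R : realType) (early : bool) (T : \bar R) : set R :=
  [set t | (early || (0 <= t)) /\ (t%:E <= T)%E].

(* A closed interval [p.1, p.2] is a point when p.1 = p.2. *)
Definition tame_support (R : realType) (F : R -> R) : Prop :=
  forall a b : R, exists s : seq (R * R),
    cdf_support F `&` `[a, b] =
    [set t | exists2 p, p \in s & p.1 <= t <= p.2].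

Definition symmetric_equilibrium (R : realType) (N : nat)
    (alpha gamma mu : R) (early : bool) (T : \bar R)
    (F : cumulativeBounded (0 : R) (1 : R)) (d : measure_display)
    (Omega : measurableType d) (P : probability Omega R)
    (M : arrival_model N mu F P) : Prop :=
  cdf_support F `<=` admissible early T /\
  exists ce : R,
    (forall t, cdf_support F t -> cost M alpha gamma t = ce) /\
    (forall t, admissible early T t -> ce <= cost M alpha gamma t).

(* F' = f on D: at the endpoints of an interval D the derivative is the
   one-sided one (F has a kink there in general).  Continuity is two-sided,
   so that F has no atom in D. *)
Definition density_on (R : realType) (D : set R) (F f : R -> R) : Prop :=
  forall t, D t ->
    {for t, continuous F} /\
    (F s - F t) / (s - t) @[s --> within D t^'] --> f t.

(* Main.v *)
(* The start of service of customer i is independent of his service time, so that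
   by lack of memory the expected number of departures by time t grows at rate
   mu P(somebody is in the system at t). The cost of arriving at t >= 0 is
   (alpha / mu + gamma) E(arrivals by t) - alpha / mu E(departures by t); its
   constancy on the support gives the density there. There are no atoms, as
   arriving just before an atom is cheaper (this leaves only the opening time when
   early arrivals are forbidden), and the support has no gaps, as the cost strictly
   decreases while nobody arrives. *)
From HB Require Import structures.
Require Import Defs.
From mathcomp Require Import all_boot all_order all_algebra.
From mathcomp Require Import perm ring lra.
From mathcomp Require Import all_classical all_reals all_analysis.
From mathcomp Require Import measurable_realfun.
Import Order.TTheory GRing.Theory Num.Theory.
Import numFieldNormedType.Exports.
Local Open Scope classical_set_scope.
Local Open Scope ring_scope.
Set Implicit Arguments.
Unset Strict Implicit.
Unset Printing Implicit Defensive.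

(** Neither [F] nor the law of the queue is known to be differentiable, so increments are compared
    instead. Over a step of length h the expected departures differ from mu * h * P(busy) by at most
    a constant times h * (increment of [F] + h): apart from the second-order effect of the
    exponential law, the error comes from services that start within the step, and each of these is
    triggered by an arrival or by another departure. On the support, equal costs make the increment
    of [F] proportional to that of the departures; dividing by h leaves an error that vanishes by
    continuity of [F]. Excluding atoms is thus what yields the derivative. No Markov property of the
    whole queue is invoked. Being in service is an event about one customer's start and his own
    service time; for different customers these events are disjoint and their union is the busy
    event, so that their probabilities add up. *)

Section SamplePath.

(** * Sample paths of the FCFS queue *)

Context {R : realType} {n m : nat} (key : 'I_n -> R * 'I_m) (s : 'I_n -> R).
Implicit Types (i j : 'I_n) (u : R).

Definition service_start i : R :=
  Num.max (key i).1
    (\big[Num.max/0]_(j < n | before (key j) (key i)) departure key s j).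

Lemma departure_start i : departure key s i = service_start i + s i.
Proof. exact: departureE. Qed.

Lemma service_start_leP i u : 0 <= u ->
  reflect ((key i).1 <= u /\
           forall j, before (key j) (key i) -> departure key s j <= u)
          (service_start i <= u).
Proof.
move=> u0; rewrite ge_max; apply: (iffP andP) => -[iu].
  by move/bigmax_leP => [_ h]; split => // j /h.
by move=> h; split => //; apply/bigmax_leP; split.
Qed.

Lemma service_start_ge0 i : 0 <= service_start i.
Proof. by rewrite le_max bigmax_ge_id orbT. Qed.

Lemma arrival_le_start i : (key i).1 <= service_start i.
Proof. by rewrite le_max lexx. Qed.

Lemma departure_le_start i j :
  before (key j) (key i) -> departure key s j <= service_start i.
Proof.
move=> ji.
have /(service_start_leP _ (service_start_ge0 i))[_] := lexx (service_start i).
by apply.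
Qed.

(** The server never idles while somebody is present: of all customers present at [u], the one with
    the fewest predecessors must be in service, since a predecessor who had not left would be
    present with a smaller rank. *)
Lemma start_le_in_system i u : (key i).1 <= u < departure key s i -> 0 <= u ->
  exists j, service_start j <= u < departure key s j.
Proof.
move=> iu u0.
pose rank i := #|[pred j | before (key j) (key i)]|.
have [j /andP[ju uj] jmin] :=
  @arg_minnP _ i (fun j => (key j).1 <= u < departure key s j) rank iu.
exists j; rewrite uj andbT; apply/service_start_leP => //; split=> // k kj.
rewrite leNgt; apply/negP => uk.
have ku : (key k).1 <= u.
  apply: le_trans ju; move: kj; rewrite /before.
  by case/orP => [/ltW//|/andP[/eqP->]].
have := jmin k; rewrite ku uk => /(_ isT); rewrite leqNgt => /negP; apply.
apply: proper_card; apply/properP; split.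
  by apply/fintype.subsetP => h; rewrite !inE => hk; exact: before_trans hk kj.
by exists k; rewrite !inE // before_irr.
Qed.

Lemma before_total (p q : R * 'I_m) : p <> q -> before p q || before q p.
Proof.
case: p q => [p1 p2] [q1 q2] pq; rewrite /before /=.
case: (ltgtP p1 q1) => //= e; rewrite -neq_ltn; apply/eqP => e2.
by apply: pq; rewrite e; congr pair; apply/val_inj.
Qed.

(** Of two customers with distinct keys one is ahead, and the other starts only after his
    departure. *)
Lemma start_le_in_system_uniq i j u : injective key ->
  service_start i <= u < departure key s i ->
  service_start j <= u < departure key s j -> i = j.
Proof.
move=> keyI /andP[iu ui] /andP[ju uj]; apply: contrapT => ij.
have : key i <> key j by move=> /keyI.
move/before_total => /orP[] /departure_le_start; rewrite leNgt => /negP; apply.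
  exact: le_lt_trans ju ui.
exact: le_lt_trans iu uj.
Qed.

End SamplePath.

(** Only the service times of those ahead enter the recursion. Stated for every amount of fuel so
    that the induction goes through. *)
Lemma departure_rec_local {R : realType} {n m : nat} (key : 'I_n -> R * 'I_m)
    (s s' : 'I_n -> R) (i : 'I_n) (k : nat) (j : 'I_n) :
  (forall l, before (key l) (key i) -> s l = s' l) ->
  before (key j) (key i) ->
  departure_rec key s k j = departure_rec key s' k j.
Proof.
move=> ss'; elim: k j => //= k IH j ji; rewrite ss' //.
congr (Num.max _ _ + _); apply: eq_bigr => l lj.
by apply: IH; exact: before_trans lj ji.
Qed.

Lemma service_start_local {R : realType} {n m : nat} (key : 'I_n -> R * 'I_m)
    (s s' : 'I_n -> R) (i : 'I_n) :
  (forall j, j != i -> s j = s' j) ->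
  service_start key s i = service_start key s' i.
Proof.
move=> ss'; congr (Num.max _ _); apply: eq_bigr => j ji.
apply: departure_rec_local ji => l li; apply: ss'.
by apply: contraTneq li => ->; rewrite before_irr.
Qed.

(** * Measurability of the queue *)

Lemma measurable_bool_set {d} {T : measurableType d} (f : T -> bool) :
  measurable_fun setT f -> measurable [set w | f w].
Proof.
move=> mf; have := mf measurableT [set true] I.
by rewrite setTI preimage_true.
Qed.

Section MeasurableQueue.
Context {R : realType} {n m : nat} {d : measure_display} {T : measurableType d}.
Context (key : T -> 'I_n -> R * 'I_m) (s : T -> 'I_n -> R).
Hypothesis key1_meas : forall i, measurable_fun setT (fun w => (key w i).1).
Hypothesis key2_meas : forall i j,
  measurable_fun setT (fun w => ((key w i).2 < (key w j).2)%N).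
Hypothesis s_meas : forall i, measurable_fun setT (s ^~ i).

Lemma measurable_before i j :
  measurable_fun setT (fun w => before (key w i) (key w j)).
Proof.
apply: measurable_or; first exact: measurable_fun_ltr.
by apply: measurable_and; [exact: measurable_fun_eqr|exact: key2_meas].
Qed.

Lemma measurable_bigmax_before (g : 'I_n -> T -> R) i :
  (forall j, measurable_fun setT (g j)) ->
  measurable_fun setT (fun w =>
    \big[Num.max/0]_(j < n | before (key w j) (key w i)) g j w).
Proof.
move=> gm; under eq_fun do rewrite bigmax_mkcond.
elim: (index_enum _) => [|j r IH].
  by under eq_fun do rewrite big_nil; exact: measurable_cst.
under eq_fun do rewrite big_cons.
apply: measurable_maxr IH; apply: measurable_fun_ifT => //.
exact: measurable_before.
Qed.

Lemma measurable_departure_rec k i :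
  measurable_fun setT (fun w => departure_rec (key w) (s w) k i).
Proof.
elim: k i => //= k IH i; apply: measurable_funD; last exact: s_meas.
apply: measurable_maxr; first exact: key1_meas.
exact: measurable_bigmax_before.
Qed.

Lemma measurable_service_start i :
  measurable_fun setT (fun w => service_start (key w) (s w) i).
Proof.
apply: measurable_maxr; first exact: key1_meas.
by apply: measurable_bigmax_before => j; exact: measurable_departure_rec.
Qed.

End MeasurableQueue.

Lemma prE {R : realType} {d} {T : measurableType d} (P : probability T R)
  (A : set T) : measurable A -> P A = (fine (P A))%:E.
Proof. by move=> mA; rewrite fineK// fin_num_measure. Qed.

(** * Independence of one service time from all other inputs *)

Section Independence.
Context {R : realType} {N : nat} {mu : R}.
Context {F : cumulativeBounded (0 : R) (1 : R)}.
Context {d : measure_display} {Omega : measurableType d}.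
Context {P : probability Omega R} (M : arrival_model N mu F P).

(* Generates the sigma-algebra of all the inputs of the queue except the service
   time of i. *)
Definition others_cylinder (i : 'I_N) : set (set Omega) :=
  [set E | exists A B s,
    [/\ forall j, measurable (A j : set R), forall j, measurable (B j : set R),
        B i = setT &
        E = [set w | forall j, A j (arr M j w)] `&`
            [set w | forall j, B j (srv M j w)] `&` (tie M @^-1` [set s])]].

Lemma measurable_cylinder (A B : 'I_N -> set R) s :
  (forall j, measurable (A j)) -> (forall j, measurable (B j)) ->
  measurable ([set w | forall j, A j (arr M j w)] `&`
    [set w | forall j, B j (srv M j w)] `&` (tie M @^-1` [set s])).
Proof.
have fa (X : 'I_N -> {RV P >-> R}) (C : 'I_N -> set R) :
    (forall j, measurable (C j)) -> measurable [set w | forall j, C j (X j w)].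
  move=> mC; rewrite (_ : [set _ | _] = \bigcap_(j in setT) (X j @^-1` C j)).
    apply: fin_bigcap_measurable => // j _.
    by rewrite -[X in measurable X]setTI; exact: measurable_funPT.
  by apply/seteqP; split=> w h; [move=> j _; exact: h|move=> j; exact: h].
move=> mA mB; apply: measurableI; last exact: measurable_tie.
by apply: measurableI; exact: fa.
Qed.

Lemma setI_closed_others_cylinder i : setI_closed (others_cylinder i).
Proof.
move=> _ _ [A [B [s [mA mB Bi ->]]]] [A' [B' [s' [mA' mB' Bi' ->]]]].
have [<-|ss'] := eqVneq s s'.
  exists (fun j => A j `&` A' j), (fun j => B j `&` B' j), s; split.
  - by move=> j; exact: measurableI.
  - by move=> j; exact: measurableI.
  - by rewrite Bi Bi' setIT.
  apply/seteqP; split => w /=.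
    by move=> [[[h1 h2] h3] [[h1' h2'] _]]; do 2 split => //.
  move=> [[h1 h2] h3]; repeat split => //.
  - by move=> j; have [] := h1 j.
  - by move=> j; have [] := h2 j.
  - by move=> j; have [] := h1 j.
  - by move=> j; have [] := h2 j.
(* Different permutations make the intersection empty; the empty set is still a cylinder, with
   impossible arrival conditions, because the customer [i] exists. *)
exists (fun=> set0), (fun=> setT), s; split => //.
apply/seteqP; split => w /=.
  by move=> [[_ h] [_ h']]; case/eqP: ss'; rewrite -h -h'.
by move=> [[h _] _]; case: (h i).
Qed.

Lemma indep_others_cylinder i (E : set Omega) (B : set R) :
  measurable B -> others_cylinder i E ->
  P (E `&` (srv M i @^-1` B)) = (P E * P (srv M i @^-1` B))%E.
Proof.
move=> mB [A [B' [s [mA mB' Bi ->]]]].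
(* The condition on [srv M i] goes into the slot that the cylinder leaves free, so that the product
   formula of the model applies to the intersection. *)
pose B'' j := if j == i then B else B' j.
have mB'' j : measurable (B'' j) by rewrite /B''; case: ifP.
rewrite [X in P X = _](_ : _ = [set w | forall j, A j (arr M j w)] `&`
    [set w | forall j, B'' j (srv M j w)] `&` (tie M @^-1` [set s])); last first.
  apply/seteqP; split => w /=.
    move=> [[[h1 h2] h3] h4]; split => //; split => // j.
    by rewrite /B''; case: eqP => [->|].
  move=> [[h1 h2] h3]; repeat split => //.
    move=> j; have := h2 j; rewrite /B''; case: eqP => // -> _.
    by rewrite Bi.
  by have := h2 i; rewrite /B'' eqxx.
rewrite !model_indep //.
have -> : (\prod_(j < N) P (srv M j @^-1` B'' j) =
    P (srv M i @^-1` B) * \prod_(j < N) P (srv M j @^-1` B' j))%E.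
  rewrite (bigD1 i)//= [in RHS](bigD1 i)//= Bi preimage_setT probability_setT.
  rewrite mul1e {1}/B'' eqxx; congr (_ * _)%E; apply: eq_bigr => j /negbTE ji.
  by rewrite /B'' ji.
by rewrite [RHS]muleAC -!muleA; congr (_ * _)%E; rewrite muleCA.
Qed.

(** Pi-lambda argument: the events independent of [S] form a lambda-system, and it contains the
    cylinders, which are closed under intersection. *)
Lemma indep_others i (E : set Omega) (B : set R) :
  measurable B -> <<s others_cylinder i >> E ->
  P (E `&` (srv M i @^-1` B)) = (P E * P (srv M i @^-1` B))%E.
Proof.
move=> mB; set S := srv M i @^-1` B.
have mS : measurable S by rewrite -[S]setTI; exact: measurable_funPT.
suff h : <<s others_cylinder i >> `<=`
    [set E | measurable E /\ P (E `&` S) = (P E * P S)%E].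
  by move=> /h[].
apply: lambda_system_subset => //; first exact: setI_closed_others_cylinder.
  apply/dynkin_lambda_system; split => /=.
  - by split => //; rewrite setTI probability_setT mul1e.
  - move=> A [mA AS]; split; first exact: measurableC.
    rewrite setIC -setDE measureD ?ltry//; last first.
      by rewrite -ge0_fin_numE// fin_num_measure.
    rewrite (setIC S) [X in (_ - X)%E]AS probability_setC//.
    have [a Pa] : exists a, P A = a%:E by eexists; exact: prE.
    have [b Pb] : exists b, P S = b%:E by eexists; exact: prE.
    rewrite Pa Pb [X in (X - _)%E]Pb.
    by rewrite -EFinM -!EFinB -EFinM mulrBl mul1r.
  - move=> G tG h; have mG k : measurable (G k) by case: (h k).
    split; first exact: bigcup_measurable.
    have -> : P (\bigcup_k G k) = (\sum_(k <oo) P (G k))%E.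
      by rewrite measure_bigcup//; apply: eq_eseriesl => k; rewrite in_setT.
    have -> : P ((\bigcup_k G k) `&` S) = (\sum_(k <oo) P (G k `&` S))%E.
      rewrite setI_bigcupl measure_bigcup//.
      - by apply: eq_eseriesl => k; rewrite in_setT.
      - by move=> k _; exact: measurableI.
      - exact: trivIset_setIr.
    have [b Sb] : exists b, P S = b%:E by eexists; exact: prE.
    rewrite Sb muleC -nneseriesZl//.
    by apply: eq_eseriesr => k _; rewrite muleC -Sb; case: (h k).
move=> E0 hE; split; last exact: indep_others_cylinder.
by case: hE => [A [B' [s [mA mB' _ ->]]]]; exact: measurable_cylinder.
Qed.

End Independence.

(** * Real-valued probabilities *)

Section RealProbability.
Context {R : realType} {d : measure_display} {T : measurableType d}.
Context (P : probability T R).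
Implicit Types A B : set T.
Local Notation pr A := (fine (P A)).

Lemma pr_ge0 A : 0 <= pr A.
Proof. exact/fine_ge0. Qed.

Lemma pr_le1 A : measurable A -> pr A <= 1.
Proof. by move=> mA; rewrite -lee_fin -prE// probability_le1. Qed.

Lemma pr_le A B : measurable A -> measurable B -> A `<=` B -> pr A <= pr B.
Proof. by move=> mA mB AB; rewrite -lee_fin -!prE// le_measure ?inE. Qed.

Lemma prU A B : measurable A -> measurable B -> A `&` B `<=` set0 ->
  pr (A `|` B) = pr A + pr B.
Proof.
move=> mA mB; rewrite subset0 => AB0; apply: EFin_inj.
by rewrite EFinD -!prE ?measureU//; exact: measurableU.
Qed.

Lemma prC A : measurable A -> pr (~` A) = 1 - pr A.
Proof.
move=> mA; apply: EFin_inj.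
by rewrite EFinB -!prE ?probability_setC//; exact: measurableC.
Qed.

Lemma prU_le A B : measurable A -> measurable B -> pr (A `|` B) <= pr A + pr B.
Proof.
move=> mA mB; have mB' := measurableD mB mA.
have -> : A `|` B = A `|` (B `\` A) by rewrite setUDr setDv setD0.
rewrite prU//; first by rewrite lerD2l pr_le//; exact: subDsetl.
by move=> w [? []].
Qed.

Lemma pr_bigU_le {I : Type} (r : seq I) (A : I -> set T) :
  (forall i, measurable (A i)) ->
  pr (\big[setU/set0]_(i <- r) A i) <= \sum_(i <- r) pr (A i).
Proof.
move=> mA; elim: r => [|i r IH]; first by rewrite !big_nil measure0.
rewrite !big_cons (le_trans (prU_le _ _))// ?lerD2l//.
exact: bigsetU_measurable.
Qed.

Lemma pr_eq0_sub A B : measurable A -> measurable B -> A `<=` B ->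
  pr B = 0 -> pr A = 0.
Proof.
by move=> mA mB AB B0; apply/eqP; rewrite eq_le pr_ge0 andbT -B0 pr_le.
Qed.

Lemma pr_ae_le A B C : measurable A -> measurable B -> measurable C ->
  pr C = 0 -> A `<=` B `|` C -> pr A <= pr B.
Proof.
move=> mA mB mC C0 AB; rewrite -[leRHS]addr0 -C0 (le_trans _ (prU_le _ _))//.
by apply: pr_le => //; exact: measurableU.
Qed.

(** In this and the next two definitions [X] stands for the start of service of one customer and [S]
    for his service time. *)
Definition in_service_prob (X S : T -> R) (t : R) : R :=
  pr [set w | X w <= t /\ t < X w + S w].

Definition start_prob (X : T -> R) (s t : R) : R :=
  pr [set w | s < X w /\ X w <= t].

Definition done_prob (X S : T -> R) (t : R) : R := pr [set w | X w + S w <= t].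

(** * One exponential service with an independent start *)

Section Memoryless.
Context (X S : {RV P >-> R}) (mu : R).
Hypothesis indepXS : forall A B : set R, measurable A -> measurable B ->
  P (X @^-1` A `&` S @^-1` B) = (P (X @^-1` A) * P (S @^-1` B))%E.
Hypothesis expS : forall c : R, 0 <= c -> P (S @^-1` `]c, +oo[) = (expR (- mu * c))%:E.

(** A product measure is determined by its values on rectangles, where [indepXS] gives them. *)
Lemma joint_lawE (C : set (R * R)) : measurable C ->
  P [set w | C (X w, S w)] = (distribution P X \x distribution P S)%E C.
Proof.
move=> mC; pose f w := (X w, S w).
have mf : measurable_fun setT f.
  by apply/measurable_fun_pairP; split; exact: measurable_funPT.
pose fM : {mfun T >-> (R * R)%type} :=
  HB.pack f (isMeasurableFun.Build _ _ _ _ f mf).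
rewrite (@product_measure_unique _ _ _ _ _ _ _ (pushforward P fM))//.
Qed.

(** By Fubini it suffices to fix a start x <= t: the section is then the tail of [S] beyond t + h -
    x, and the exponential tail splits off the factor for h. *)
Lemma memoryless_after (t h : R) : 0 <= h ->
  P [set w | X w <= t /\ t + h < X w + S w] =
  ((expR (- mu * h))%:E * P [set w | (X w <= t /\ t < X w + S w)%R])%E.
Proof.
move=> h0; pose C (h : R) := [set z : R * R | z.1 <= t /\ t + h < z.1 + z.2].
have mC k : measurable (C k).
  apply: measurableI; apply: measurable_bool_set.
    by apply: measurable_fun_ler => //; exact: measurable_fst.
  by apply: measurable_fun_ltr => //; apply: measurable_funD.
have -> : [set w | X w <= t /\ t < X w + S w] = [set w | C 0 (X w, S w)].
  by rewrite /C/= addr0.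
rewrite (@joint_lawE (C h))// joint_lawE//.
rewrite /product_measure1 -ge0_integralZl_EFin//; last exact: measurable_fun_xsection.
apply: eq_integral => x _ /=.
have sec k : xsection (C k) x = if x <= t then `]t + k - x, +oo[%classic else set0.
  apply/seteqP; split => s; rewrite /xsection/= inE /C/=.
    by case => -> /=; rewrite in_itv/= andbT ltrBlDl.
  by case: ifP => // _ /=; rewrite in_itv/= andbT ltrBlDl.
rewrite !sec; case: ifP => xt; last by rewrite measure0 mule0.
rewrite /distribution/pushforward !expS; [|lra..].
by rewrite -EFinM -expRD; congr (expR _)%:E; lra.
Qed.


Hypothesis mu_gt0 : 0 < mu.

Let XS_meas : measurable_fun setT (X \+ S).
Proof. exact: measurable_funD. Qed.

Let measX_le (t : R) : measurable [set w | X w <= t].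
Proof. by apply: measurable_bool_set; exact: measurable_fun_ler. Qed.

Let measX_gt (t : R) : measurable [set w | t < X w].
Proof. by apply: measurable_bool_set; exact: measurable_fun_ltr. Qed.

Let measXS_le (t : R) : measurable [set w | X w + S w <= t].
Proof. by apply: measurable_bool_set; exact: measurable_fun_ler. Qed.

Let measXS_gt (t : R) : measurable [set w | t < X w + S w].
Proof. by apply: measurable_bool_set; exact: measurable_fun_ltr. Qed.

Local Ltac meas := first
  [ done | exact: measX_le | exact: measX_gt | exact: measXS_le
  | exact: measXS_gt | (apply: measurableD; meas) | (apply: measurableU; meas)
  | (apply: measurableI; meas) ].

Local Notation in_service := (in_service_prob X S).
Local Notation start_in := (start_prob X).
Local Notation done_by := (done_prob X S).

Let done_by_incr (s t : R) : s <= t ->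
  done_by t - done_by s = pr [set w | s < X w + S w /\ X w + S w <= t].
Proof.
move=> st; apply/eqP; rewrite subr_eq addrC -prU//; last 2 first.
- meas.
- by move=> w [/= h [h' _]]; move: h'; rewrite ltNge h.
apply/eqP; congr (fine (P _)); apply/seteqP; split => w /=.
  by move=> h; case: (leP (X w + S w) s); [left|right].
by case=> [/le_trans|[]//]; apply.
Qed.

Lemma pr_service_le (c : R) : 0 <= c -> pr [set w | S w <= c] = 1 - expR (- mu * c).
Proof.
move=> c0; have -> : [set w | S w <= c] = ~` (S @^-1` `]c, +oo[).
  by apply/seteqP; split => w /=; rewrite in_itv/= andbT leNgt => /negP.
rewrite prC ?expS//.
by rewrite -[X in measurable X]setTI; exact: measurable_funPT.
Qed.

(** A customer in service at [t] leaves within [h] with probability 1 - exp(- mu h), by lack of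
    memory; services starting after [t] are ignored. *)
Lemma done_by_incr_ge (t h : R) : 0 <= h ->
  (1 - expR (- mu * h)) * in_service t <= done_by (t + h) - done_by t.
Proof.
move=> h0; rewrite done_by_incr; last by rewrite lerDl.
rewrite mulrBl mul1r lerBlDr.
have -> : expR (- mu * h) * in_service t = pr [set w | X w <= t /\ t + h < X w + S w].
  by rewrite memoryless_after// (@prE _ _ _ P [set w | _ /\ t < _])//; meas.
apply: le_trans (prU_le _ _); [|meas|meas].
apply: pr_le; [meas|meas|].
move=> w /= [Xt th]; case: (leP (X w + S w) (t + h)) => k; [left|right]; split => //.
Qed.

(** Whoever leaves during the step was in service at [t] or started during the step. In the second
    case his service time is at most [h], which is independent of the start and has the same
    probability 1 - exp(- mu h). *)
Lemma done_by_incr_le (t h : R) : 0 <= h ->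
  done_by (t + h) - done_by t <=
  (1 - expR (- mu * h)) * (in_service t + start_in t (t + h)).
Proof.
move=> h0; rewrite done_by_incr; last by rewrite lerDl.
have mA : measurable [set w | X w <= t /\ t < X w + S w] by meas.
have mB : measurable [set w | X w <= t /\ t + h < X w + S w] by meas.
have mS c : measurable [set w | S w <= c].
  by apply: measurable_bool_set; exact: measurable_fun_ler.
have mXS : measurable [set w | (t < X w /\ X w <= t + h) /\ S w <= h].
  by apply: measurableI; [meas|exact: mS].
have -> : (1 - expR (- mu * h)) * (in_service t + start_in t (t + h)) =
    pr ([set w | X w <= t /\ t < X w + S w] `\`
        [set w | X w <= t /\ t + h < X w + S w]) +
    pr [set w | (t < X w /\ X w <= t + h) /\ S w <= h].
  rewrite mulrDr; congr (_ + _).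
    rewrite mulrBl mul1r; apply/eqP; rewrite subr_eq; apply/eqP.
    have -> : expR (- mu * h) * in_service t =
        pr [set w | X w <= t /\ t + h < X w + S w].
      by rewrite memoryless_after// (prE P mA).
    rewrite -prU//; last 2 first.
    - meas.
    - by move=> w [[]].
    congr (fine (P _)); rewrite setUC; apply/esym/setDUK => w /= [-> k].
    by split => //; apply: le_lt_trans k; rewrite lerDl.
  have := @indepXS `]t, t + h] `]-oo, h] (measurable_itv _) (measurable_itv _).
  rewrite (_ : X @^-1` _ = [set w | t < X w /\ X w <= t + h]); last first.
    by apply/seteqP; split => w /=; rewrite in_itv/= => /andP.
  rewrite (_ : S @^-1` _ = [set w | S w <= h]); last first.
    by apply/seteqP; split => w /=; rewrite in_itv.
  rewrite (_ : _ `&` _ = [set w | (t < X w /\ X w <= t + h) /\ S w <= h])// => ->.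
  rewrite mulrC -pr_service_le// (prE P (mS h)) fineM//.
  by rewrite fin_num_measure//; meas.
apply: le_trans (prU_le _ _) => //; last meas.
(* Nonpositive service times are discarded as a null event: they would allow a departure within the
   step from a start after it. *)
apply: (@pr_ae_le _ _ [set w | S w <= 0]) => //.
- meas.
- meas.
- by rewrite pr_service_le// mulr0 expR0 subrr.
move=> w /= [k1 k2]; case: (leP (S w) 0) => S0; [by right|left].
case: (leP (X w) t) => Xt; [left|right].
  by split => // -[_]; rewrite ltNge k2.
by split; [split => //|]; lra.
Qed.

(** The event of being in service changes only through a start or a departure in between. *)
Lemma in_service_incr_le (s t : R) : s <= t ->
  `|in_service t - in_service s| <= start_in s t + (done_by t - done_by s).
Proof.
move=> st.
have m1 u : measurable [set w | X w <= u /\ u < X w + S w] by meas.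
have m2 : measurable [set w | s < X w /\ X w <= t] by meas.
have m3 : measurable [set w | s < X w + S w /\ X w + S w <= t] by meas.
have h1 : in_service t <= in_service s + start_in s t.
  apply: le_trans (prU_le _ _) => //; apply: pr_le => //; first meas.
  move=> w /= [k1 k2]; case: (leP (X w) s) => Xs; [left|right] => //.
  by split => //; exact: le_lt_trans k2.
have h2 : in_service s <= in_service t + (done_by t - done_by s).
  rewrite done_by_incr//; apply: le_trans (prU_le _ _) => //.
  apply: pr_le => //; first meas.
  move=> w /= [k1 k2]; case: (leP (X w + S w) t) => Xt; [right|left] => //.
  by split => //; exact: le_trans st.
have h3 : 0 <= start_in s t by exact: pr_ge0.
have h4 : 0 <= done_by t - done_by s by rewrite done_by_incr// pr_ge0.
rewrite ler_norml; apply/andP; split; lra.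
Qed.

Lemma expR_compl_bounds (x : R) : 0 <= x -> x - x ^+ 2 <= 1 - expR (- x) <= x.
Proof.
move=> x0; have := expR_ge1Dx x; have := expR_ge1Dx (- x).
rewrite expRN; have e0 := expR_gt0 x; set e := expR x in e0 * => h1 h2.
apply/andP; split; last by lra.
have -> : 1 - e^-1 = (e - 1) / e by rewrite mulrBl divff ?lt0r_neq0// mul1r.
(* The lower bound amounts to 1 <= e * (1 - x + x^2), which follows from 1 + x <= e since (1 + x) *
   (1 - x + x^2) = 1 + x^3. *)
have q0 : 0 <= 1 - x + x ^+ 2 by nra.
have := ler_wpM2r q0 h1.
have : 0 <= x ^+ 3 by rewrite exprn_ge0.
by rewrite ler_pdivlMr//; nra.
Qed.

(** The upper bound of [done_by_incr_le] has rate at most mu, because being in service at [s] and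
    starting after [s] are disjoint events. *)
Lemma done_by_incr_lip (s t : R) : s <= t ->
  0 <= done_by t - done_by s <= mu * (t - s).
Proof.
move=> st; rewrite {1}done_by_incr// pr_ge0/=.
have h0 : 0 <= t - s by rewrite subr_ge0.
have stE : s + (t - s) = t by lra.
have := done_by_incr_le s h0; rewrite stE => /le_trans; apply.
have /expR_compl_bounds/andP[_ e2] : 0 <= mu * (t - s) by rewrite mulr_ge0// ltW.
have e0 : 0 <= 1 - expR (- (mu * (t - s))).
  by rewrite subr_ge0 -expR0 ler_expR oppr_le0 mulr_ge0// ltW.
rewrite mulNr; apply: le_trans e2; rewrite -[leRHS]mulr1 ler_wpM2l//.
have m1 : measurable [set w | X w <= s /\ s < X w + S w] by meas.
have m2 : measurable [set w | s < X w /\ X w <= t] by meas.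
rewrite /in_service_prob /start_prob -prU//.
  by rewrite pr_le1//; apply: measurableU.
by move=> w [/= [k _] [k' _]]; move: k'; rewrite ltNge k.
Qed.

(** Both ends are allowed for [u] so that right and left difference quotients are covered. The
    estimate is natural at [s]; passing to [t] costs the change of [in_service], whence the factor
    2. *)
Lemma done_by_derive (s t u : R) : s <= t -> u = s \/ u = t ->
  `|done_by t - done_by s - mu * (t - s) * in_service u| <=
  2 * (mu * (t - s)) * (mu * (t - s) + start_in s t).
Proof.
move=> st ut; have h0 : 0 <= t - s by rewrite subr_ge0.
have := done_by_incr_le s h0; have := done_by_incr_ge s h0.
have /andP[l0 l1] := done_by_incr_lip st.
have := in_service_incr_le st; rewrite ler_norml => /andP[i1 i2].
have m0 : 0 <= mu * (t - s) by rewrite mulr_ge0// ltW.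
have /andP[e1 e2] := expR_compl_bounds m0.
have -> : s + (t - s) = t by lra.
rewrite mulNr; set e := expR _ in e1 e2 *; set x := mu * (t - s) in m0 e1 e2 l1 *.
have m1 : measurable [set w | X w <= s /\ s < X w + S w] by meas.
have g0 : 0 <= in_service s by exact: pr_ge0.
have g1 : in_service s <= 1 by exact: pr_le1.
have j0 : 0 <= start_in s t by exact: pr_ge0.
move: l0 l1 i1 i2 g0 g1 j0.
set D := done_by t - done_by s; set G := in_service s; set J := start_in s t.
move=> l0 l1 i1 i2 g0 g1 j0 h1 h2.
have a1 : x * G - x ^+ 2 <= D.
  apply: le_trans h1; apply: (@le_trans _ _ ((x - x ^+ 2) * G)); last first.
    by rewrite ler_wpM2r.
  by rewrite mulrBl lerD2l lerN2 ler_piMr// sqr_ge0.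
have a2 : D <= x * (G + J).
  by apply: le_trans h2 _; rewrite ler_wpM2r// addr_ge0.
have xj : 0 <= x * J by rewrite mulr_ge0.
have x2 : 0 <= x ^+ 2 by rewrite sqr_ge0.
have b1 : x * (in_service t - G) <= x * (J + D) by rewrite ler_wpM2l.
have b2 : x * - (J + D) <= x * (in_service t - G) by rewrite ler_wpM2l.
have b3 : x * D <= x ^+ 2 by rewrite expr2 ler_wpM2l.
by case: ut => ->; rewrite ler_norml -/G; apply/andP; split; lra.
Qed.

End Memoryless.
End RealProbability.

Lemma measurable_fun_of_fin {d} {T : measurableType d} {I : finType} (f : T -> I)
    (Q : I -> bool) : (forall i, measurable (f @^-1` [set i])) ->
  measurable_fun setT (fun w => Q (f w)).
Proof.
move=> mf; apply: (measurable_fun_bool true); rewrite setTI.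
rewrite (_ : _ @^-1` _ = \bigcup_(i in [set i | Q i]) (f @^-1` [set i])).
  exact: fin_bigcup_measurable.
by apply/seteqP; split => w /=; [move=> Qw; exists (f w)|case=> i Qi ->].
Qed.

(** * Starts and departures as random variables of the model *)

Section Model.
Context {R : realType} {N : nat} {mu : R}.
Context {F : cumulativeBounded (0 : R) (1 : R)}.
Context {d : measure_display} {Omega : measurableType d}.
Context {P : probability Omega R} (M : arrival_model N mu F P).
Implicit Types (i j : 'I_N) (t : R).
Local Notation pr A := (fine (P A)).

Lemma srv_tail i (c : R) : 0 <= c ->
  P (srv M i @^-1` `]c, +oo[) = (expR (- mu * c))%:E.
Proof.
move=> c0.
have neg0 : P (srv M i @^-1` `]-oo, 0[) = 0%E.
  have := @srv_law _ _ _ _ _ _ _ M i `]-oo, 0[ (measurable_itv _).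
  rewrite /distribution/pushforward => ->.
  by apply: integral0_eq => x /=; rewrite in_itv/= => x0; rewrite lt0_exponential_pdf.
have itv0c : P (srv M i @^-1` `[0, c]) = (1 - expR (- mu * c))%:E.
  have := @srv_law _ _ _ _ _ _ _ M i `[0, c] (measurable_itv _).
  rewrite /distribution/pushforward => ->.
  (* The closed form of the exponential mass of [[0, c]] is applied for c > 0; for c = 0 the
     interval is a point, of mass zero. *)
  move: c0; rewrite le_eqVlt => /orP[/eqP<-|c0]; last first.
    by rewrite exponential_prob_itv0c.
  by rewrite set_itv1 /exponential_prob integral_set1 mulr0 expR0 subrr.
have mpre (I : interval R) : measurable (srv M i @^-1` [set` I]).
  by rewrite -[X in measurable X]setTI; exact: measurable_funPT.
have -> : srv M i @^-1` `]c, +oo[ =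
    ~` (srv M i @^-1` `]-oo, 0[ `|` srv M i @^-1` `[0, c]).
  apply/seteqP; split => w /=; rewrite !in_itv/= andbT.
    by move=> cw [w0|/andP[_ wc]]; move: cw; rewrite ltNge ?wc// (le_trans (ltW w0) c0).
  by move=> /not_orP[/negP]; rewrite -leNgt => -> /=; rewrite ltNge => /negP.
rewrite probability_setC; last exact: measurableU.
rewrite measureU//.
  rewrite [X in (_ - (X + _))%E]neg0 [X in (_ - (_ + X))%E]itv0c add0e.
  by rewrite -EFinB opprB addrC subrK.
apply/seteqP; split => w //=; rewrite !in_itv/= => -[w0 /andP[w1 _]].
by move: w0; rewrite ltNge w1.
Qed.

Lemma measurable_tie_fun (Q : 'S_N.+1 -> bool) :
  measurable_fun setT (fun w => Q (tie M w)).
Proof.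
by apply: measurable_fun_of_fin => s; exact: measurable_tie.
Qed.

Lemma measurable_key2 i j :
  measurable_fun setT (fun w => ((key M w i).2 < (key M w j).2)%N).
Proof.
exact: (measurable_tie_fun
  (fun s : {perm _} => (s (lift ord_max i) < s (lift ord_max j))%N)).
Qed.

Definition start i (w : Omega) : R :=
  service_start (key M w) (fun j => srv M j w) i.

Definition dep i (w : Omega) : R := departure (key M w) (fun j => srv M j w) i.

Lemma depE i w : dep i w = start i w + srv M i w.
Proof. exact: departure_start. Qed.

Lemma measurable_start i : measurable_fun setT (start i).
Proof.
by apply: measurable_service_start => // *; exact: measurable_key2.
Qed.

(** Makes [start M i] a random variable, as required of [X] in the results on one exponential
    service. *)
HB.instance Definition _ i :=
  isMeasurableFun.Build _ _ _ _ (start i) (measurable_start i).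

Lemma measurable_dep i : measurable_fun setT (dep i).
Proof.
apply: (eq_measurable_fun (start i \+ srv M i)) => [w _|]; first by rewrite depE.
exact: measurable_funD.
Qed.

Section Others.
Variable i : 'I_N.
(** [Omega] with the smaller sigma-algebra of all inputs except the service time of [i]: a function
    measurable on [T'] is independent of [srv M i]. *)
Local Notation T' := (g_sigma_algebraType (others_cylinder M i)).

Let mgen (E : set Omega) : others_cylinder M i E -> measurable (E : set T').
Proof. exact: sub_sigma_algebra. Qed.

Let mtie s : measurable (tie M @^-1` [set s] : set T').
Proof.
apply: mgen; exists (fun=> setT), (fun=> setT), s; split => //.
by apply/seteqP; split => w //= [].
Qed.

(** A cylinder prescribes the permutation; an event that does not is a finite union of cylinders
    over all permutations. *)
Let bigcup_tie (E : set Omega) :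
  E = \bigcup_(s in setT) (E `&` (tie M @^-1` [set s])).
Proof. by apply/seteqP; split => w; [exists (tie M w)|case=> s _ []]. Qed.

Let others_tie (Q : 'S_N.+1 -> bool) :
  measurable_fun setT (fun w : T' => Q (tie M w)).
Proof.
by apply: measurable_fun_of_fin => s; exact: mtie.
Qed.

Lemma others_arr j : measurable_fun setT (arr M j : T' -> R).
Proof.
move=> _ Y mY; rewrite setTI [X in measurable X]bigcup_tie.
apply: fin_bigcup_measurable => [|s _]; first exact: (@finite_finset {perm 'I_N.+1}).
apply: mgen; exists (fun k => if k == j then Y else setT), (fun=> setT), s.
split => //; first by move=> k; case: ifP.
apply/seteqP; split => w /= -[h1 h2]; split => //.
  by split => // k; case: eqP => [->|].
by case: h1 => /(_ j); rewrite eqxx.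
Qed.

Let others_srv j : j != i -> measurable_fun setT (srv M j : T' -> R).
Proof.
move=> ji _ Y mY; rewrite setTI [X in measurable X]bigcup_tie.
apply: fin_bigcup_measurable => [|s _]; first exact: (@finite_finset {perm 'I_N.+1}).
apply: mgen; exists (fun=> setT), (fun k => if k == j then Y else setT), s.
split => //; first by move=> k; case: ifP.
  by rewrite eq_sym (negbTE ji).
apply/seteqP; split => w /= -[h1 h2]; split => //.
  by split => // k; case: eqP => [->|].
by case: h1 => _ /(_ j); rewrite eqxx.
Qed.

Lemma others_start : measurable_fun setT (start i : T' -> R).
Proof.
(* Overwriting the service time of [i] by a constant leaves his start unchanged and removes the one
   input that is not measurable on [T']. *)
pose srv0 (w : T') j := if j == i then 0 else srv M j w.
have msrv0 j : measurable_fun setT (srv0 ^~ j).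
  by rewrite /srv0; case: eqP => [_|/eqP /others_srv//]; exact: measurable_cst.
have -> : start i = (fun w : T' => service_start (key M w) (srv0 w) i).
  apply/funext => w; apply: service_start_local => j ji.
  by rewrite /srv0 (negbTE ji).
apply: measurable_service_start => // [j|j k]; first exact: others_arr.
exact: (others_tie (fun s : {perm _} => (s (lift ord_max j) < s (lift ord_max k))%N)).
Qed.

Lemma others_indep (X : Omega -> R) (A B : set R) :
  measurable_fun setT (X : T' -> R) -> measurable A -> measurable B ->
  P (X @^-1` A `&` srv M i @^-1` B) = (P (X @^-1` A) * P (srv M i @^-1` B))%E.
Proof.
move=> mX mA mB; apply: indep_others => //.
by have := mX measurableT _ mA; rewrite setTI.
Qed.

End Others.

End Model.

(** * Expected departures and the busy server *)

Section Throughput.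
Context {R : realType} {N : nat} {mu : R}.
Context {F : cumulativeBounded (0 : R) (1 : R)}.
Context {d : measure_display} {Omega : measurableType d}.
Context {P : probability Omega R} (M : arrival_model N mu F P).
Hypothesis mu_gt0 : 0 < mu.
Implicit Types (i j : 'I_N) (s t u : R).
Local Notation pr A := (fine (P A)).
Local Notation in_service i t := (in_service_prob P (start M i) (srv M i) t).
Local Notation departed i t := (done_prob P (start M i) (srv M i) t).

Lemma measurable_lef (f g : Omega -> R) : measurable_fun setT f ->
  measurable_fun setT g -> measurable [set w | f w <= g w].
Proof. by move=> mf mg; apply: measurable_bool_set; exact: measurable_fun_ler. Qed.

Lemma measurable_ltf (f g : Omega -> R) : measurable_fun setT f ->
  measurable_fun setT g -> measurable [set w | f w < g w].
Proof. by move=> mf mg; apply: measurable_bool_set; exact: measurable_fun_ltr. Qed.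

Lemma bigsetU_existsE (A : 'I_N -> set Omega) :
  \big[setU/set0]_(i < N) A i = [set w | exists i, A i w].
Proof.
rewrite -bigcup_seq; apply/seteqP; split => w /= [i]; first by exists i.
by exists i => //=; exact: mem_index_enum.
Qed.

Lemma arr_le i t : pr [set w | arr M i w <= t] = F t.
Proof.
have := arr_law M i t; rewrite /cdf /distribution /pushforward.
rewrite (_ : _ @^-1` _ = [set w | arr M i w <= t]); first by move=> ->.
by apply/seteqP; split => w /=; rewrite in_itv.
Qed.

Lemma arr_in i s t : s <= t -> pr [set w | s < arr M i w /\ arr M i w <= t] = F t - F s.
Proof.
move=> st; rewrite -!(arr_le i); apply/eqP; rewrite eq_sym subr_eq addrC -prU.
- apply/eqP; congr (fine (P _)); apply/seteqP; split => w /=.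
    by move=> h; case: (leP (arr M i w) s); [left|right].
  by case=> [/le_trans|[]//]; apply.
- exact: measurable_lef.
- by apply: measurableI; [exact: measurable_ltf|exact: measurable_lef].
- by move=> w [/= h [h' _]]; move: h'; rewrite ltNge h.
Qed.

Lemma departedE i t : departed i t = pr [set w | dep M i w <= t].
Proof. by congr (fine (P _)); apply/seteqP; split => w /=; rewrite depE. Qed.

(** No service starts before the opening, so that a departure by then requires a nonpositive service
    time. *)
Lemma departed_le0 i t : t <= 0 -> departed i t = 0.
Proof.
move=> t0; apply: (@pr_eq0_sub _ _ _ P _ [set w | srv M i w <= 0]).
- by apply: measurable_lef => //; apply: measurable_funD.
- exact: measurable_lef.
- move=> w /= h; have := service_start_ge0 (key M w) (fun j => srv M j w) i.
  by rewrite -/(start M i w); lra.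
- by rewrite (pr_service_le (srv_tail M i))// mulr0 expR0 subrr.
Qed.

Lemma departed_lip i s t : s <= t ->
  0 <= departed i t - departed i s <= mu * (t - s).
Proof.
move=> st; apply: done_by_incr_lip => //; last exact: srv_tail.
by move=> A B mA mB; apply: others_indep => //; exact: others_start.
Qed.

(** A service that starts in ]s, t] was not possible at [s]: either the customer himself had not
    arrived, or somebody ahead had not left and leaves in ]s, t]. The union bound over the
    departures, each at rate at most mu, gives the second term. *)
Lemma start_prob_le i s t : 0 <= s -> s <= t ->
  start_prob P (start M i) s t <= F t - F s + N%:R * (mu * (t - s)).
Proof.
move=> s0 st.
pose D j := [set w | s < dep M j w /\ dep M j w <= t].
have mD j : measurable (D j).
  by apply: measurableI; [apply: measurable_ltf|apply: measurable_lef] => //;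
    exact: measurable_dep.
have mA : measurable [set w | s < arr M i w /\ arr M i w <= t].
  by apply: measurableI; [exact: measurable_ltf|exact: measurable_lef].
have prD j : pr (D j) <= mu * (t - s).
  have /andP[_] := departed_lip j st; apply: le_trans; rewrite !departedE.
  rewrite lerBrDl -prU//.
  - apply: pr_le; [apply: measurableU => //| |].
    + by apply: measurable_lef => //; exact: measurable_dep.
    + by apply: measurable_lef => //; exact: measurable_dep.
    + by move=> w [/= h|[]//]; exact: le_trans st.
  - by apply: measurable_lef => //; exact: measurable_dep.
  - by move=> w [/= h [h' _]]; move: h'; rewrite ltNge h.
have mU : measurable (\big[setU/set0]_(j < N) D j) by exact: bigsetU_measurable.
apply: (@le_trans _ _ (pr ([set w | s < arr M i w /\ arr M i w <= t] `|`
    \big[setU/set0]_(j < N) D j))).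
  apply: pr_le; last move=> w /= [sX Xt].
  - by apply: measurableI; [exact: measurable_ltf|exact: measurable_lef].
  - exact: measurableU.
  have t0 := le_trans s0 st.
  have /(service_start_leP _ _ _ t0)[/= at_ dt] := Xt.
  case: (leP (arr M i w) s) => as_; [right|by left].
  move: sX; rewrite ltNge => /negP sX.
  have [j ji sj] : exists2 j, before (key M w j) (key M w i) & s < dep M j w.
    apply: contrapT => h; apply: sX; apply/service_start_leP => //; split => // j ji.
    by rewrite leNgt; apply/negP => sj; apply: h; exists j.
  by rewrite bigsetU_existsE; exists j; split => //; exact: dt.
rewrite -(arr_in i st); apply: le_trans (prU_le P mA mU) _; rewrite lerD2l.
apply: le_trans (pr_bigU_le P _ mD) _.
apply: le_trans (ler_sum _ (fun j _ => prD j)) _.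
by rewrite sumr_const card_ord mulr_natl.
Qed.

(** Unlike [num_present], this includes every opponent arriving exactly at [t], whatever his rank;
    the law of the queue then needs no tagged customer. *)
Definition busy t := [set w | exists i, arr M i w <= t < dep M i w].

Lemma busyE t : 0 <= t ->
  busy t = \big[setU/set0]_(i < N)
    [set w | start M i w <= t /\ t < start M i w + srv M i w].
Proof.
move=> t0; rewrite bigsetU_existsE; apply/seteqP; split => w /=.
  case=> i /start_le_in_system /(_ t0)[j]; rewrite departure_start => /andP[h1 h2].
  by exists j.
case=> i [h1 h2]; exists i; rewrite depE h2 andbT.
by apply: le_trans h1; exact: (arrival_le_start (key M w) (fun j => srv M j w) i).
Qed.

Lemma key_inj w : injective (key M w).
Proof. by move=> i j [_ /perm_inj/lift_inj]. Qed.

Lemma measurable_in_service i t :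
  measurable [set w | start M i w <= t /\ t < start M i w + srv M i w].
Proof.
by apply: measurableI; [apply: measurable_lef|apply: measurable_ltf] => //;
  apply: measurable_funD.
Qed.

Lemma measurable_busy t : 0 <= t -> measurable (busy t).
Proof.
move=> t0; rewrite busyE//; apply: bigsetU_measurable => i _.
exact: measurable_in_service.
Qed.

(* At most one customer is in service, and somebody is as soon as somebody has
   arrived and not left. *)
Lemma pr_busy t : 0 <= t -> pr (busy t) = \sum_(i < N) in_service i t.
Proof.
move=> t0; rewrite busyE// measure_bigsetU_ord//=; last 2 first.
- by move=> i; exact: measurable_in_service.
- apply/trivIsetP => i j _ _ ij; apply/seteqP; split => w //= [[h1 h2] [h3 h4]].
  case/eqP: ij.
  apply: (start_le_in_system_uniq (s := fun j => srv M j w) (u := t) (@key_inj w)).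
    by rewrite departure_start -/(start M i w) h1 h2.
  by rewrite departure_start -/(start M j w) h3 h4.
rewrite -sum_fine// => i _; rewrite fin_num_measure//.
exact: measurable_in_service.
Qed.

(** A cumulative quantity, not a rate: the expected number of departures by [t]. *)
Definition throughput t : R := \sum_(i < N) departed i t.

Lemma throughput_le0 t : t <= 0 -> throughput t = 0.
Proof. by move=> t0; rewrite /throughput big1// => i _; exact: departed_le0. Qed.

Lemma throughput_lip s t : s <= t ->
  0 <= throughput t - throughput s <= N%:R * (mu * (t - s)).
Proof.
move=> st; rewrite /throughput -sumrB; apply/andP; split.
  by apply: sumr_ge0 => i _; case/andP: (departed_lip i st).
have -> : N%:R * (mu * (t - s)) = \sum_(i < N) mu * (t - s).
  by rewrite sumr_const card_ord mulr_natl.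
by apply: ler_sum => i _; case/andP: (departed_lip i st).
Qed.

(** Sum of [done_by_derive] over the customers. In the factor N + 1, N comes from the departures
    that may trigger a start and 1 from the customer's own service. *)
Lemma throughput_derive s t u : 0 <= s -> s <= t -> u = s \/ u = t ->
  `|throughput t - throughput s - mu * (t - s) * pr (busy u)| <=
  2 * mu * N%:R * (t - s) * (F t - F s + (N.+1)%:R * mu * (t - s)).
Proof.
move=> s0 st ut; have t0 := le_trans s0 st.
rewrite pr_busy; last by case: ut => ->.
rewrite /throughput -sumrB mulr_sumr -sumrB.
have -> : 2 * mu * N%:R * (t - s) * (F t - F s + (N.+1)%:R * mu * (t - s)) =
  \sum_(i < N) 2 * (mu * (t - s)) *
    (mu * (t - s) + (F t - F s + N%:R * (mu * (t - s)))).
  by rewrite sumr_const card_ord -mulr_natl -natr1; lra.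
apply: (le_trans (ler_norm_sum _ _ _)); apply: ler_sum => i _.
apply: le_trans (done_by_derive _ _ _ st ut) _ => //.
- by move=> A B mA mB; apply: others_indep => //; exact: others_start.
- exact: srv_tail.
rewrite ler_wpM2l//; last by rewrite lerD2l start_prob_le.
have h0 : 0 <= mu * (t - s) by apply: mulr_ge0; [exact: ltW|rewrite subr_ge0].
by rewrite mulr_ge0.
Qed.

Lemma throughput_incr_ge s t : 0 <= s -> s <= t ->
  (1 - expR (- mu * (t - s))) * pr (busy s) <= throughput t - throughput s.
Proof.
move=> s0 st; rewrite pr_busy// /throughput -sumrB mulr_sumr.
apply: ler_sum => i _.
have h0 : 0 <= t - s by rewrite subr_ge0.
have -> : departed i t = departed i (s + (t - s)) by congr (done_prob _ _ _ _); lra.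
apply: done_by_incr_ge => //; last exact: srv_tail.
by move=> A B mA mB; apply: others_indep => //; exact: others_start.
Qed.

(** An opponent who has arrived by [t] and needs more than [t] units of service is still there,
    since his service cannot start before 0; the two conditions are independent. *)
Lemma pr_busy_ge i t : 0 <= t -> F t * expR (- mu * t) <= pr (busy t).
Proof.
move=> t0.
have h := @others_indep _ _ _ _ _ _ _ M i (arr M i) `]-oo, t] `]t, +oo[
  (@others_arr _ _ _ _ _ _ _ M i i) (measurable_itv _) (measurable_itv _).
have e1 : arr M i @^-1` `]-oo, t] = [set w | arr M i w <= t].
  by apply/seteqP; split => w /=; rewrite in_itv.
rewrite e1 (srv_tail M _ t0)// in h.
have -> : F t * expR (- mu * t) =
    pr ([set w | arr M i w <= t] `&` srv M i @^-1` `]t, +oo[).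
  by rewrite h -(arr_le i) fineM// fin_num_measure//; exact: measurable_lef.
apply: pr_le; [|exact: measurable_busy|].
  apply: measurableI; first exact: measurable_lef.
  by rewrite -[X in measurable X]setTI; exact: measurable_funPT.
move=> w [/= at_]; rewrite in_itv/= andbT => st; exists i; rewrite at_ /=.
apply: (lt_le_trans st); rewrite depE lerDr.
exact: service_start_ge0.
Qed.

End Throughput.

(** * Left limits of the arrival distribution *)

Section LeftLimit.
Context {R : realType} (F : cumulativeBounded (0 : R) (1 : R)).
Implicit Types s t : R.

Lemma cdf_le : {homo F : s t / s <= t}.
Proof. exact: cumulative_is_nondecreasing. Qed.

Definition left_limit t : R := sup [set F s | s in `]-oo, t[].

Lemma left_limit_ub s t : s < t -> F s <= left_limit t.
Proof.
move=> st; apply: ub_le_sup; last by exists s => //=; rewrite in_itv.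
exists (F t) => _ [u /= + <-]; rewrite in_itv/= => ut.
by apply: cdf_le; exact: ltW.
Qed.

Lemma left_limit_adherent t (e : R) : 0 < e ->
  exists2 s, s < t & left_limit t - e < F s.
Proof.
move=> e0; have : has_sup [set F s | s in `]-oo, t[].
  split; first by exists (F (t - 1)), (t - 1) => //=; rewrite in_itv/= ltrBlDr ltrDl.
  exists (F t) => _ [u /= + <-]; rewrite in_itv/= => ut.
  by apply: cdf_le; exact: ltW.
move=> /(sup_adherent e0)[_ [s /= + <-]]; rewrite in_itv/= => st h.
by exists s.
Qed.

Lemma left_limit_le t : left_limit t <= F t.
Proof.
apply: ge_sup.
  by exists (F (t - 1)), (t - 1) => //=; rewrite in_itv/= ltrBlDr ltrDl.
move=> _ [u /= + <-]; rewrite in_itv/= => ut.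
by apply: cdf_le; exact: ltW.
Qed.

End LeftLimit.

(** * The cost in terms of expected arrivals and departures *)

Section Cost.
Context {R : realType} {N : nat} {mu : R}.
Context {F : cumulativeBounded (0 : R) (1 : R)}.
Context {d : measure_display} {Omega : measurableType d}.
Context {P : probability Omega R} (M : arrival_model N mu F P).
Hypothesis mu_gt0 : 0 < mu.
Implicit Types (i j : 'I_N) (t u : R).
Local Notation pr A := (fine (P A)).
Local Notation departed i t := (done_prob P (start M i) (srv M i) t).

Lemma measurable_ahead t i : measurable [set w | ahead M t w i].
Proof.
apply: measurable_bool_set; apply: measurable_or => /=.
  exact: measurable_fun_ltr.
apply: measurable_and; first exact: measurable_fun_eqr.
exact: (measurable_tie_fun M
  (fun s : {perm _} => (s (lift ord_max i) < s ord_max)%N)).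
Qed.

Let measurable_arr_eq i t : measurable [set w | arr M i w = t].
Proof.
rewrite (_ : [set _ | _] = [set w | arr M i w == t]); last first.
  by apply/seteqP; split => w /= /eqP.
by apply: measurable_bool_set; exact: measurable_fun_eqr.
Qed.

Lemma pr_tie i t (s : 'S_N.+1) :
  pr [set w | arr M i w = t /\ tie M w = s] =
  pr [set w | arr M i w = t] * ((N.+1)`!%:R)^-1.
Proof.
pose A k : set R := if k == i then [set t] else setT.
have mA k : measurable (A k) by rewrite /A; case: ifP.
have := @model_indep _ _ _ _ _ _ _ M A (fun=> setT) s mA (fun=> measurableT).
rewrite (_ : _ `&` _ = [set w | arr M i w = t /\ tie M w = s]); last first.
  apply/seteqP; split => w /=.
    by move=> [[/(_ i)]]; rewrite /A eqxx.
  move=> [at_ ts]; split => //; split => // k; rewrite /A.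
  by case: eqP => // ->.
rewrite tie_law (bigD1 i)//= big1; last first.
  by move=> k /negbTE ki; rewrite /A ki preimage_setT probability_setT.
rewrite big1 => [|k _]; last by rewrite preimage_setT probability_setT.
rewrite !mule1 {1}/A eqxx => ->.
by rewrite fineM// fin_num_measure//; exact: measurable_arr_eq.
Qed.

Lemma arr_lt_eq i t : pr [set w | arr M i w < t] + pr [set w | arr M i w = t] = F t.
Proof.
rewrite -(arr_le M i) -prU//.
- congr (fine (P _)); apply/seteqP; split => w /=.
    by case=> [/ltW//|->].
  by rewrite le_eqVlt => /orP[/eqP|]; [right|left].
- exact: measurable_ltf.
- by move=> w [/= h e]; move: h; rewrite e ltxx.
Qed.

(** One inequality is continuity from below along t - 1/(n+1), the other monotonicity. *)
Lemma arr_lt i t : pr [set w | arr M i w < t] = left_limit F t.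
Proof.
have mlt : measurable [set w | arr M i w < t] by exact: measurable_ltf.
apply/eqP; rewrite eq_le; apply/andP; split.
  pose E n := [set w | arr M i w <= t - n.+1%:R^-1].
  have mE n : measurable (E n) by exact: measurable_lef.
  have UE : \bigcup_n E n = [set w | arr M i w < t].
    apply/seteqP; split => w /=.
      by case=> n _ /= h; apply: (le_lt_trans h); rewrite ltrBlDr ltrDl invr_gt0.
    rewrite -subr_gt0 => /ltr_add_invr[n]; rewrite add0r => h; exists n => //=.
    by rewrite /E /= lerBrDr -lerBrDl ltW.
  have ndE : nondecreasing_seq E.
    move=> m n mn; apply/subsetPset => w /= h; apply: (le_trans h).
    by rewrite lerD2l lerN2 lef_pV2 ?posrE// ler_nat.
  have := @nondecreasing_cvg_mu _ _ _ P E mE.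
  rewrite UE => /(_ mlt ndE) h.
  rewrite -lee_fin -prE//; move/cvg_lim : h => <- //.
  apply: lime_le.
    apply: ereal_nondecreasing_is_cvgn => m n mn.
    by rewrite le_measure ?inE//; exact/subsetPset/ndE.
  apply: nearW => n /=; rewrite (prE P (mE n)) lee_fin (arr_le M i).
  by apply: left_limit_ub; rewrite ltrBlDr ltrDl invr_gt0.
apply: ge_sup.
  by exists (F (t - 1)), (t - 1) => //=; rewrite in_itv/= ltrBlDr ltrDl.
move=> _ [u /= + <-]; rewrite in_itv/= => ut; rewrite -(arr_le M i).
apply: pr_le => //; first exact: measurable_lef.
by move=> w /= /le_lt_trans; apply.
Qed.

Definition expected_ahead t : R := \sum_(i < N) pr [set w | ahead M t w i].

(** Of the jump at [t], random tie-breaking puts one half ahead of the tagged customer. Only a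
    positive share on either side matters later, and a single permutation, of probability 1/(N+1)!,
    provides it. *)
Lemma expected_ahead_bounds t :
  N%:R * (left_limit F t + (N.+1)`!%:R^-1 * (F t - left_limit F t)) <=
    expected_ahead t <=
  N%:R * (F t - (N.+1)`!%:R^-1 * (F t - left_limit F t)).
Proof.
set q := (N.+1)`!%:R^-1.
suff h i : left_limit F t + q * (F t - left_limit F t) <= pr [set w | ahead M t w i] <=
    F t - q * (F t - left_limit F t).
  have e x : N%:R * x = \sum_(i < N) x by rewrite sumr_const card_ord mulr_natl.
  by rewrite !e; apply/andP; split; apply: ler_sum => i _; case/andP: (h i).
have mlt : measurable [set w | arr M i w < t] by exact: measurable_ltf.
have mtie s : measurable [set w | arr M i w = t /\ tie M w = s].
  by apply: measurableI; [exact: measurable_arr_eq|exact: (measurable_tie M s)].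
have ltm : ((lift ord_max i : 'I_N.+1) < (ord_max : 'I_N.+1))%N.
  by rewrite /= /bump (leqNgt N) ltn_ord add0n ltn_ord.
have eqE : F t - left_limit F t = pr [set w | arr M i w = t].
  by rewrite -(arr_lt i) -(arr_lt_eq i); lra.
rewrite eqE mulrC; apply/andP; split.
  (* The identity ranks the tagged customer last, hence behind [i]. *)
  rewrite -(pr_tie i t 1) -(arr_lt i) -prU//.
    apply: pr_le; [exact: measurableU|exact: measurable_ahead|].
    move=> w [h|[h1 h2]]; rewrite /= /ahead /before; first by rewrite h.
    apply/orP; right; apply/andP; split; first exact/eqP.
    change (is_true (tie M w (lift ord_max i) < tie M w ord_max)%N).
    by rewrite h2 !perm1.
  by move=> w /= [k [h _]]; move: k; rewrite h ltxx.
(* Exchanging the two ranks puts [i] last, hence behind the tagged customer. *)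
rewrite -(pr_tie i t (tperm (lift ord_max i) ord_max)) lerBrDr -prU//.
- rewrite -(arr_le M i); apply: pr_le.
  + by apply: measurableU => //; exact: measurable_ahead.
  + exact: measurable_lef.
  + move=> w /= [|[-> //]]; rewrite /ahead /before /= => /orP[/ltW//|].
    by case/andP => /eqP->.
- exact: measurable_ahead.
move=> w [h [h1 h2]]; move: h => /orP[|/andP[_]].
  by change (arr M i w < t -> set0 w); rewrite h1 ltxx.
change (tie M w (lift ord_max i) < tie M w ord_max -> set0 w)%N.
by rewrite h2 tpermL tpermR ltnNge ltnW.
Qed.

Lemma expectation_card (E : 'I_N -> set Omega) (p : Omega -> pred 'I_N) :
  (forall i, measurable (E i)) -> (forall i w, E i w <-> p w i) ->
  fine ('E_P[fun w => #|[pred i | p w i]|%:R])%E = \sum_(i < N) pr (E i).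
Proof.
move=> mE Ep.
have -> : (fun w => #|[pred i | p w i]|%:R : R) = (fun w => \sum_(i < N) \1_(E i) w).
  apply/funext => w; rewrite -sum1_card natr_sum big_mkcond/=; apply: eq_bigr => i _.
  rewrite indicE; case: ifPn => h; rewrite inE in h.
    by rewrite mem_set//; exact/Ep.
  by rewrite memNset// => /Ep; exact/negP.
rewrite unlock; under eq_integral do rewrite -sumEFin.
rewrite ge0_integral_sum//; last first.
  by move=> i; apply/measurable_EFinP; exact: measurable_indic.
rewrite (eq_bigr (fun i => P (E i))); last first.
  by move=> i _; rewrite integral_indic// setIT.
by rewrite -sum_fine// => i _; rewrite fin_num_measure.
Qed.

(** Whoever has left by [t] was almost surely ahead: his service time is positive, so that he
    arrived strictly before [t] and tie-breaking does not matter. *)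
Lemma expected_present t :
  \sum_(i < N) pr [set w | ahead M t w i /\ t < dep M i w] =
  expected_ahead t - throughput M t.
Proof.
have mdep (i : 'I_N) := measurable_dep M i.
have mgt i : measurable [set w | t < dep M i w] by exact: measurable_ltf.
have ma i := measurable_ahead t i.
rewrite /expected_ahead /throughput -sumrB; apply: eq_bigr => i _.
have mle : measurable [set w | dep M i w <= t] by exact: measurable_lef.
rewrite departedE; apply/eqP; rewrite eq_sym subr_eq; apply/eqP.
have -> : pr [set w | dep M i w <= t] = pr [set w | ahead M t w i /\ dep M i w <= t].
  apply/eqP; rewrite eq_le; apply/andP; split; last first.
    by apply: pr_le => //; [apply: measurableI; [exact: ma|exact: mle]|move=> w []].
  apply: (@pr_ae_le _ _ _ _ _ _ [set w | srv M i w <= 0]) => //.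
  - by apply: measurableI; [exact: ma|exact: mle].
  - exact: measurable_lef.
  - by rewrite (pr_service_le (srv_tail M i))// mulr0 expR0 subrr.
  move=> w /= h; case: (leP (srv M i w) 0) => s0; [by right|left]; split => //.
  rewrite /ahead /before/= (_ : arr M i w < t)//.
  have := arrival_le_start (key M w) (fun j => srv M j w) i.
  by rewrite -/(start M i w) /=; move: h; rewrite depE; lra.
rewrite -prU; [|by apply: measurableI; [exact: ma|exact: mgt]
               |by apply: measurableI; [exact: ma|exact: mle]|].
  congr (fine (P _)); apply/seteqP; split => w /=; last by case=> -[].
  by move=> h; case: (leP (dep M i w) t); [right|left].
by move=> w [/= [_ h] [_]]; rewrite leNgt h.
Qed.

Lemma throughput_le_ahead t : throughput M t <= expected_ahead t.
Proof.
by rewrite -subr_ge0 -expected_present; apply: sumr_ge0 => i _; exact: pr_ge0.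
Qed.

Lemma costE alpha gamma t :
  cost M alpha gamma t = alpha * Num.max (- t) 0 +
    (alpha / mu + gamma) * expected_ahead t - alpha / mu * throughput M t.
Proof.
have mdep (i : 'I_N) := measurable_dep M i.
have mgt i : measurable [set w | t < dep M i w] by exact: measurable_ltf.
have ma i := measurable_ahead t i.
have -> : cost M alpha gamma t = - alpha * t * (t < 0)%R%:R
    + alpha / mu * \sum_(i < N) pr [set w | ahead M t w i /\ t < dep M i w]
    + gamma * expected_ahead t.
  congr (_ + _ * _ + _ * _).
    apply: (expectation_card (p := fun w i => ahead M t w i && (t < dep M i w))).
      by move=> i; apply: measurableI; [exact: ma|exact: mgt].
    by move=> i w; split => /andP.
  by apply: (expectation_card (p := fun w i => ahead M t w i)).
rewrite expected_present.
have -> : - alpha * t * (t < 0)%R%:R = alpha * Num.max (- t) 0.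
  rewrite /Num.max oppr_lt0; case: ltgtP => //= t0; rewrite ?mulr0 ?mulr1//.
    by rewrite mulNr mulrN.
  by rewrite t0 oppr0 mulr0.
rewrite /expected_ahead; lra.
Qed.

(** The two events differ only through opponents arriving exactly at [t], a null event without an
    atom there. *)
Lemma prob_emptyE t : 0 <= t -> left_limit F t = F t ->
  1 - prob_empty M t = pr (busy M t).
Proof.
move=> t0 Ft.
have mdep (i : 'I_N) := measurable_dep M i.
pose E i := [set w | ahead M t w i /\ t < dep M i w].
have mE i : measurable (E i).
  by apply: measurableI; [exact: measurable_ahead|exact: measurable_ltf].
have mU : measurable (\big[setU/set0]_(i < N) E i) by exact: bigsetU_measurable.
have mb := measurable_busy M t0.
have -> : prob_empty M t = 1 - pr (\big[setU/set0]_(i < N) E i).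
  rewrite -prC// /prob_empty; congr (fine (P _)); rewrite bigsetU_existsE.
  apply/seteqP; split => w /=.
    move=> /card0_eq h [i [ha hd]]; have := h i; rewrite inE ha hd.
    by [].
  move=> h; apply: eq_card0 => i; rewrite inE; apply/negP => /andP[ha hd].
  by apply: h; exists i.
rewrite subKr; apply/eqP; rewrite eq_le; apply/andP; split.
  apply: pr_le => //; rewrite bigsetU_existsE => w [i [ha hd]]; exists i.
  rewrite hd andbT; move: ha; rewrite /ahead /before/= => /orP[/ltW//|].
  by case/andP => /eqP->.
apply: (@pr_ae_le _ _ _ _ _ _ (\big[setU/set0]_(i < N) [set w | arr M i w = t])) => //.
- exact: bigsetU_measurable.
- apply/eqP; rewrite eq_le pr_ge0 andbT (le_trans (pr_bigU_le _ _ _))//.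
  by rewrite big1// => i _; have := arr_lt_eq i t; rewrite arr_lt; lra.
rewrite !bigsetU_existsE => w [i /andP[ha hd]].
move: ha; rewrite le_eqVlt => /orP[/eqP ha|ha]; [right|left]; exists i => //.
by split => //; rewrite /ahead /before/= ha.
Qed.

End Cost.

(** * Support and continuity of a distribution function *)

Section CdfSupport.
Context {R : realType} (F : cumulativeBounded (0 : R) (1 : R)).
Implicit Types s t x y c e : R.

Lemma cdf_lt_ex c : 0 < c -> exists x, F x < c.
Proof.
move=> c0; have := cumulativeNy F.
move=> /cvgrPdist_lt/(_ _ c0)[x [xr h]]; exists (x - 1).
have := h (x - 1); rewrite ltrBlDr ltrDl => /(_ ltr01); rewrite sub0r normrN.
exact: le_lt_trans (ler_norm _).
Qed.

Lemma cdf_gt_ex c : c < 1 -> exists y, c < F y.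
Proof.
move=> c1; have := cumulativey F; rewrite -subr_gt0 in c1.
move=> /cvgrPdist_lt/(_ _ c1)[x [xr h]]; exists (x + 1).
have := h (x + 1); rewrite ltrDl => /(_ ltr01).
by move=> /(le_lt_trans (ler_norm _)); lra.
Qed.

Lemma cdf_right_cont t e : 0 < e ->
  exists2 r, 0 < r & forall s, t <= s -> s < t + r -> F s < F t + e.
Proof.
move=> e0; have /cvgrPdist_lt/(_ _ e0) := @cumulative_is_right_continuous _ _ _ F t.
move=> [r /= r0 h]; exists r => // s; rewrite le_eqVlt => /orP[/eqP<-|ts sr].
  by move=> _; rewrite ltrDl.
have tsr : ball_ Num.norm t r s.
  by rewrite /ball_ /= distrC ger0_norm ?subr_ge0 ?ltW// ltrBlDl.
by have := h s tsr ts; rewrite distrC => /(le_lt_trans (ler_norm _)); lra.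
Qed.

(** The witness is the quantile inf {s | c <= F s}: right continuity gives c <= F at it, while F < c
    strictly to its left, so that it is a point of increase. This is how points of the support are
    produced throughout. *)
Lemma quantile_in_support x y c : F x < c -> c <= F y ->
  exists q, [/\ x < q, q <= y, cdf_support F q & c <= F q].
Proof.
move=> Fx Fy; pose S := [set s | c <= F s].
have Sx s : S s -> x < s.
  move=> /= cs; rewrite ltNge; apply/negP => /(cdf_le F) sx.
  by move: (le_trans cs sx); rewrite leNgt Fx.
have Sinf : has_inf S by split; [exists y|exists x => s /Sx/ltW].
pose q := inf S.
have qS s : s < q -> F s < c.
  move=> sq; rewrite ltNge; apply/negP => cs; move: sq; rewrite ltNge.
  by rewrite (ge_inf _ _)//; case: Sinf.
have Fq : c <= F q.
  rewrite leNgt; apply/negP => qc.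
  have d0 : 0 < c - F q by rewrite subr_gt0.
  have [r r0 h] := cdf_right_cont q d0.
  have [s /= cs sq] := inf_adherent r0 Sinf.
  have := h s; rewrite ge_inf//; last by case: Sinf.
  by move=> /(_ isT sq); move: (cs : c <= F s); lra.
exists q; split => //; first exact: Sx.
  by apply: ge_inf => //; case: Sinf.
move=> e e0; apply: (@lt_le_trans _ _ c); first by apply: qS; lra.
by apply: (le_trans Fq); apply: cdf_le; lra.
Qed.

Lemma cdf_const x y : x <= y -> (forall s, x < s <= y -> ~ cdf_support F s) ->
  F y = F x.
Proof.
move=> xy h; apply/eqP; rewrite eq_le (cdf_le F xy) andbT leNgt.
apply/negP => /(fun k => quantile_in_support k (lexx _))[q [xq qy Fq _]].
by apply: (h q) => //; rewrite xq qy.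
Qed.

Lemma cdf_support_closed t :
  (forall e, 0 < e -> exists2 s, cdf_support F s & `|s - t| < e) -> cdf_support F t.
Proof.
move=> h e e0; have e20 : 0 < e / 2 by rewrite divr_gt0.
have [s Fs st] := h (e / 2) e20.
move: st; rewrite ltr_norml => /andP[h1 h2].
apply: le_lt_trans (lt_le_trans (Fs (e / 2) _) _); last 2 first.
- by rewrite divr_gt0.
- by apply: cdf_le; lra.
by apply: cdf_le; lra.
Qed.

Lemma cdf_support_sup (S : set R) : has_sup S -> S `<=` cdf_support F ->
  cdf_support F (sup S).
Proof.
move=> Ssup SF; apply: cdf_support_closed => e e0.
have [s Ss h] := sup_adherent e0 Ssup; exists s; first exact: SF.
have := ub_le_sup Ssup.2 Ss => k; rewrite ltr_norml; apply/andP; split; lra.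
Qed.

Lemma cdf_support_inf (S : set R) : has_inf S -> S `<=` cdf_support F ->
  cdf_support F (inf S).
Proof.
move=> Sinf SF; apply: cdf_support_closed => e e0.
have [s Ss h] := inf_adherent e0 Sinf; exists s; first exact: SF.
have := ge_inf Sinf.2 Ss => k; rewrite ltr_norml; apply/andP; split; lra.
Qed.

Lemma cumulative_ge0 t : 0 <= F t.
Proof.
rewrite leNgt; apply/negP => t0.
have := cumulativeNy F; rewrite -oppr_gt0 in t0.
move=> /cvgrPdist_lt/(_ _ t0)[x [xr h]]; pose z := Num.min (x - 1) t.
have zx : z < x by rewrite gt_min ltrBlDr ltrDl ltr01.
have zt : F z <= F t by apply: cdf_le; rewrite ge_min lexx orbT.
by have := h z zx; rewrite sub0r normrN ltr_norml => /andP[]; lra.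
Qed.

Lemma cumulative_le1 t : F t <= 1.
Proof.
rewrite leNgt; apply/negP => t1.
have := cumulativey F; rewrite -subr_gt0 in t1.
move=> /cvgrPdist_lt/(_ _ t1)[x [xr h]]; pose z := Num.max (x + 1) t.
have zx : x < z by rewrite lt_max ltrDl ltr01.
have zt : F t <= F z by apply: cdf_le; rewrite le_max lexx orbT.
by have := h z zx; rewrite ltr_norml => /andP[]; lra.
Qed.

Lemma cdf0_below t : (forall s, s <= t -> ~ cdf_support F s) -> F t = 0.
Proof.
move=> h; apply/eqP; rewrite eq_le cumulative_ge0 andbT leNgt; apply/negP => t0.
have [x xt] := cdf_lt_ex t0.
by have [q [_ qt /(h _ qt)]] := quantile_in_support xt (lexx _).
Qed.

Lemma left_limit_ge0 t : 0 <= left_limit F t.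
Proof.
by apply: le_trans (cumulative_ge0 (t - 1)) (left_limit_ub F _); lra.
Qed.

Lemma left_limit_off_support t : ~ cdf_support F t -> left_limit F t = F t.
Proof.
move=> /existsNP[e /not_implyP[e0 /negP]]; rewrite -leNgt => h.
apply/eqP; rewrite eq_le left_limit_le /=.
have te : t - e < t by lra.
have := left_limit_ub F te; apply: le_trans.
by apply: le_trans h; apply: cdf_le; lra.
Qed.

Lemma cdf_continuous t : left_limit F t = F t -> {for t, continuous F}.
Proof.
move=> Ft; apply/cvgrPdist_lt => e e0.
have [r r0 hr] := cdf_right_cont t e0.
have [s st hs] := left_limit_adherent F t e0.
near=> x; rewrite ltr_norml; apply/andP; split.
  have [tx|xt] := leP t x.
    have xr : x < t + r by near: x; apply: lt_nbhsl; rewrite ltrDl.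
    by have := hr x tx xr; lra.
  by have := cdf_le F (ltW xt); lra.
have sx : s < x by near: x; apply: lt_nbhsr.
by have := cdf_le F (ltW sx); lra.
Unshelve. all: by end_near. Qed.

End CdfSupport.

(** The error may be of the order of the increment of [F] itself, because continuity already makes
    that increment vanish. *)
Lemma density_on_intro {R : realType} (D : set R) (F f : R -> R) :
  (forall t, D t -> {for t, continuous F}) ->
  (forall t, D t -> exists2 C, 0 <= C & forall s, D s -> s != t ->
    `|(F s - F t) / (s - t) - f t| <= C * (`|F s - F t| + `|s - t|)) ->
  density_on D F f.
Proof.
move=> Fc h t Dt; split; first exact: Fc.
have [C C0 hC] := h t Dt.
(* C + 1 instead of C keeps the quotient meaningful when C = 0. *)
have D0 : 0 < 2 * (C + 1) by lra.
apply/cvgrPdist_lt => e e0; have e'0 : 0 < e / (2 * (C + 1)) by rewrite divr_gt0.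
have /cvgrPdist_lt/(_ _ e'0) Fct := Fc t Dt.
have /cvgrPdist_lt/(_ _ e'0) tt : id x @[x --> t] --> t by exact: cvg_id.
rewrite !near_withinE; near=> s => st Ds.
rewrite distrC; apply: le_lt_trans (hC s Ds st) _.
have k1 : `|F s - F t| < e / (2 * (C + 1)) by rewrite distrC; near: s.
have k2 : `|s - t| < e / (2 * (C + 1)).
  by rewrite distrC; near: s.
apply: (@le_lt_trans _ _ (C * (2 * (e / (2 * (C + 1)))))).
  by rewrite ler_wpM2l//; lra.
have -> : C * (2 * (e / (2 * (C + 1)))) = e * (C / (C + 1)).
  by rewrite invfM; field; lra.
by rewrite gtr_pMr// ltr_pdivrMr ?mul1r; lra.
Unshelve. all: by end_near. Qed.

(** * Shape of an equilibrium *)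

Section Equilibrium.
Context {R : realType} {N : nat} {alpha gamma mu : R}.
Context {T : \bar R} {early : bool}.
Context {F : cumulativeBounded (0 : R) (1 : R)}.
Context {d : measure_display} {Omega : measurableType d}.
Context {P : probability Omega R} (M : arrival_model N mu F P).
Hypothesis N_gt0 : (0 < N)%N.
Hypothesis alpha_gt0 : 0 < alpha.
Hypothesis gamma_gt0 : 0 < gamma.
Hypothesis mu_gt0 : 0 < mu.
Hypothesis T_gt0 : (0 < T)%E.
Variable ce : R.
Hypothesis supp_adm : cdf_support F `<=` admissible early T.
Hypothesis cost_supp : forall t, cdf_support F t -> cost M alpha gamma t = ce.
Hypothesis cost_adm : forall t, admissible early T t -> ce <= cost M alpha gamma t.
Implicit Types s t x y e : R.
Local Notation pr A := (fine (P A)).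
(** [kappa] is the price of one more opponent ahead who has not left; [q] is the probability of a
    single tie-breaking permutation. *)
Local Notation kappa := (alpha / mu + gamma).
Local Notation q := ((N.+1)`!%:R^-1 : R).
Local Notation n := (N%:R : R).

Let n_gt0 : 0 < n.
Proof. by rewrite ltr0n. Qed.

Let alphamu_gt0 : 0 < alpha / mu.
Proof. exact: divr_gt0. Qed.

Let kappa_gt0 : 0 < kappa.
Proof. by rewrite addr_gt0. Qed.

Let q_gt0 : 0 < q.
Proof. by rewrite invr_gt0 ltr0n fact_gt0. Qed.

Let q_le1 : q <= 1.
Proof. by rewrite invf_le1 ?ler1n ?ltr0n fact_gt0. Qed.

Let late_cost t : 0 <= t ->
  cost M alpha gamma t = kappa * expected_ahead M t - alpha / mu * throughput M t.
Proof.
move=> t0; rewrite costE// (_ : Num.max (- t) 0 = 0) ?mulr0 ?add0r//.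
by apply: max_r; rewrite oppr_le0.
Qed.

Let early_cost t : t <= 0 ->
  cost M alpha gamma t = - alpha * t + kappa * expected_ahead M t.
Proof.
move=> t0; rewrite costE// throughput_le0// mulr0 subr0.
by rewrite (_ : Num.max (- t) 0 = - t) ?mulrN ?mulNr//; apply: max_l; rewrite oppr_ge0.
Qed.

Let cost_ge t : gamma * expected_ahead M t <= cost M alpha gamma t.
Proof.
rewrite costE//; have h := throughput_le_ahead M t.
have : 0 <= alpha * Num.max (- t) 0.
  by apply: mulr_ge0; [exact: ltW|rewrite le_max lexx orbT].
have : 0 <= alpha / mu * (expected_ahead M t - throughput M t).
  by apply: mulr_ge0; [exact: ltW|rewrite subr_ge0].
by lra.
Qed.

Let ahead_le t : expected_ahead M t <= n * F t.
Proof.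
have /andP[_ h] := expected_ahead_bounds M t; apply: (le_trans h).
rewrite (ler_wpM2l (ltW n_gt0))// gerBl mulr_ge0 ?(ltW q_gt0)// subr_ge0.
exact: left_limit_le.
Qed.

Let ahead_ge t : n * left_limit F t <= expected_ahead M t.
Proof.
have /andP[h _] := expected_ahead_bounds M t; apply: le_trans h.
rewrite (ler_wpM2l (ltW n_gt0))// lerDl mulr_ge0 ?(ltW q_gt0)// subr_ge0.
exact: left_limit_le.
Qed.

Let ahead_gt0 t : 0 < F t -> 0 < expected_ahead M t.
Proof.
move=> Ft; have /andP[h _] := expected_ahead_bounds M t; apply: lt_le_trans h.
rewrite mulr_gt0//; have l0 := left_limit_ge0 F t.
have : 0 <= (1 - q) * left_limit F t by rewrite mulr_ge0// subr_ge0.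
have : 0 < q * F t by exact: mulr_gt0.
by lra.
Qed.

(** At a support point with F >= 1/2 somebody is ahead with positive probability, even if all that
    mass is tied. Hence arriving for free would be a profitable deviation. *)
Lemma equilibrium_cost_gt0 : 0 < ce.
Proof.
have [x Fx] : exists x, F x < 2^-1 by apply: cdf_lt_ex; lra.
have [y Fy] : exists y, 2^-1 < F y by apply: cdf_gt_ex; lra.
have [r [_ _ Fr hr]] := quantile_in_support Fx (ltW Fy).
rewrite -(cost_supp Fr); apply: lt_le_trans (cost_ge r).
by rewrite mulr_gt0// ahead_gt0//; lra.
Qed.

(* Arriving just before an atom avoids the expected queue of the customers
   sharing the atom. *)
Lemma no_atom t : early || (0 < t) -> left_limit F t = F t.
Proof.
move=> et; have [Ft|/left_limit_off_support//] := pselect (cdf_support F t).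
apply/eqP; rewrite eq_le left_limit_le /= leNgt; apply/negP => J0.
have Tt := (supp_adm Ft).2.
pose J := F t - left_limit F t; have J_gt0 : 0 < J by rewrite subr_gt0.
(* Moving forward by [e] costs at most alpha * e for waiting and alpha/mu * n * mu * e for
   departures forgone; [e] keeps this within half of the gain kappa * n * q * J. The minimum with
   [t] keeps the new time admissible without early birds. *)
pose e := Num.min (kappa * n * q * J / (2 * (alpha + alpha / mu * (n * mu))))
  (if early then 1 else t).
have am : 0 < alpha + alpha / mu * (n * mu) by rewrite addr_gt0// mulr_gt0// mulr_gt0.
have e0 : 0 < e.
  rewrite lt_min; apply/andP; split.
    by rewrite divr_gt0// !mulr_gt0.
  by move: et; case: early => //= ->.
have adm : admissible early T (t - e).
  split; last by apply: le_trans Tt; rewrite lee_fin; lra.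
  move: et; rewrite /e; case: early => //= _.
  by rewrite subr_ge0 ge_min lexx orbT.
have := cost_adm adm; rewrite -(cost_supp Ft) leNgt => /negP; apply.
have te : t - e < t by lra.
rewrite !costE//.
have /andP[h1 _] := expected_ahead_bounds M t.
have h2 := le_trans (ahead_le (t - e)) (ler_wpM2l (ltW n_gt0) (left_limit_ub F te)).
have /andP[_ h3] := throughput_lip M mu_gt0 (ltW te).
have h4 : Num.max (- (t - e)) 0 - Num.max (- t) 0 <= e.
  rewrite lerBlDr ge_max.
  by apply/andP; split; have : - t <= Num.max (- t) 0 by [rewrite le_max lexx];
    have : 0 <= Num.max (- t) 0 by [rewrite le_max lexx orbT]; lra.
have h5 : e * (alpha + alpha / mu * (n * mu)) <= kappa * n * q * J / 2.
  by rewrite -ler_pdivlMr// -[leRHS]mulrA -invfM /e ge_min lexx.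
have h6 : alpha / mu * (throughput M t - throughput M (t - e)) <=
    alpha / mu * (n * (mu * e)).
  apply: ler_wpM2l; [exact: ltW|]; apply: (le_trans h3).
  by rewrite (_ : t - (t - e) = e)//; lra.
have h7 : alpha * (Num.max (- (t - e)) 0 - Num.max (- t) 0) <= alpha * e.
  by apply: ler_wpM2l => //; exact: ltW.
have h8 : kappa * (n * (left_limit F t + q * J)) <= kappa * expected_ahead M t.
  by apply: ler_wpM2l => //; exact: ltW.
have h9 : kappa * expected_ahead M (t - e) <= kappa * (n * left_limit F t).
  by apply: ler_wpM2l => //; exact: ltW.
have h10 : 0 < kappa * n * q * J by rewrite !mulr_gt0.
move: h5 h6 h7 h8 h9 h10.
set A1 := expected_ahead M t; set A2 := expected_ahead M (t - e).
set T1 := throughput M t; set T2 := throughput M (t - e).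
set m1 := Num.max _ _; set m2 := Num.max _ _.
by lra.
Qed.

Lemma F_continuous t : early || (0 < t) -> {for t, continuous F}.
Proof. by move=> /no_atom/cdf_continuous. Qed.

Let aheadE t : early || (0 < t) -> expected_ahead M t = n * F t.
Proof.
move=> /no_atom Ft; apply/eqP; rewrite eq_le ahead_le/=.
by rewrite -[in leLHS]Ft ahead_ge.
Qed.

(* Across a gap of the support the queue only shrinks, so that the end of the
   gap would be cheaper than its beginning. *)
Lemma no_gap p t : 0 < F 0 -> cdf_support F p -> early || (0 < p) ->
  p <= t -> (t%:E <= T)%E -> cdf_support F t.
Proof.
move=> F0 Fp ep pt tT; apply: contrapT => Ft.
(* Its supremum is the left end of the gap around [t], and lies in the support because the support
   is closed. *)
pose S := [set s | cdf_support F s /\ s <= t].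
have Ssup : has_sup S by split; [exists p|exists t => s []].
have Sa : cdf_support F (sup S) by apply: cdf_support_sup => // s [].
have pa : p <= sup S by apply: (ub_le_sup Ssup.2).
have : sup S <= t by apply: (ge_sup Ssup.1) => s [].
rewrite le_eqVlt => /orP[/eqP e|at_]; first by apply: Ft; rewrite -e.
have FE : F t = F (sup S).
  apply: cdf_const; first exact: ltW.
  move=> s /andP[as_ st] Fs; move: as_; rewrite ltNge => /negP; apply.
  by apply: (ub_le_sup Ssup.2).
set a := sup S in Sa pa at_ FE.
have ea : early || (0 < a) by case: early ep => //=; lra.
have et : early || (0 < t) by case: early ea => //=; lra.
have adm : admissible early T t.
  by split => //; move: et; case: early => //= /ltW.
have := cost_adm adm; rewrite -(cost_supp Sa) leNgt => /negP; apply.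
(* If the gap begins before the opening, the strict saving is the shorter wait until time 0;
   otherwise it comes from departures during the gap. *)
have [a0|a0] := ltP a 0.
  rewrite !costE// !aheadE// FE.
  have /andP[h _] := throughput_lip M mu_gt0 (ltW at_).
  have h1 : alpha * Num.max (- t) 0 < alpha * Num.max (- a) 0.
    by rewrite ltr_pM2l// gt_max !lt_max; apply/andP; split; apply/orP; left; lra.
  have : 0 <= alpha / mu * (throughput M t - throughput M a).
    by apply: mulr_ge0 => //; exact: ltW.
  by lra.
have t0 := le_trans a0 (ltW at_).
rewrite !late_cost// !aheadE// FE ltrD2l ltrN2 ltr_pM2l// -subr_gt0.
apply: lt_le_trans (throughput_incr_ge M a0 (ltW at_)).
rewrite mulr_gt0//.
  by rewrite subr_gt0 -expR0 ltr_expR mulNr oppr_lt0 mulr_gt0// subr_gt0.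
(* The server is busy at [a] with positive probability because some opponent has arrived by then
   with probability at least [F 0]. *)
apply: lt_le_trans (pr_busy_ge M (Ordinal N_gt0) a0).
by rewrite mulr_gt0 ?expR_gt0// (lt_le_trans F0)// cdf_le.
Qed.

(** Equal costs at two support points turn an increment of [throughput] into one of [F], so that the
    expansion of the former gives the difference quotient of the latter. *)
Lemma density_late (D : set R) :
  D `<=` cdf_support F -> (forall t, D t -> 0 <= t) ->
  (forall t, D t -> early || (0 < t)) ->
  density_on D F (fun t => alpha * (1 - prob_empty M t) / (n * kappa)).
Proof.
move=> DF D0 De; apply: density_on_intro => [t /De/F_continuous//|t Dt].
have nk : 0 < n * kappa by rewrite mulr_gt0.
rewrite prob_emptyE ?D0 ?no_atom ?De//.
(* The constant of [throughput_derive], scaled by alpha/mu and 1/(n * kappa); 1 + (N+1) * mu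
   dominates the coefficients of both increments. *)
pose C := alpha / mu * (2 * mu * n) * (1 + N.+1%:R * mu) / (n * kappa).
have c0 : 0 <= alpha / mu * (2 * mu * n) by rewrite ltW// mulr_gt0// !mulr_gt0.
have c1 : 0 <= N.+1%:R * mu by apply: mulr_ge0 => //; exact: ltW.
exists C; first by rewrite divr_ge0 ?(ltW nk)// mulr_ge0// addr_ge0.
move=> s Ds st.
have eqF : kappa * n * (F s - F t) = alpha / mu * (throughput M s - throughput M t).
  have := cost_supp (DF _ Ds); rewrite -(cost_supp (DF _ Dt)).
  by rewrite !late_cost ?D0// !aheadE ?De//; lra.
have key : `|throughput M s - throughput M t - mu * (s - t) * pr (busy M t)| <=
    2 * mu * n * `|s - t| * (`|F s - F t| + N.+1%:R * mu * `|s - t|).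
  have [ts|st'] := leP t s.
    rewrite [`|F s - F t|]ger0_norm ?subr_ge0 ?cdf_le//.
    rewrite [`|s - t|]ger0_norm ?subr_ge0//.
    by apply: throughput_derive => //; [exact: D0|left].
  have ts := ltW st'; rewrite [`|F s - F t|]distrC [`|s - t|]distrC.
  rewrite [`|F t - F s|]ger0_norm ?subr_ge0 ?cdf_le//.
  rewrite [`|t - s|]ger0_norm ?subr_ge0//.
  (* For s < t the point of differentiation is the right end of the step. *)
  have := throughput_derive M mu_gt0 (D0 _ Ds) ts (or_intror erefl).
  apply: le_trans; rewrite -normrN le_eqVlt; apply/orP; left; apply/eqP.
  by congr (`|_|); lra.
have st0 : 0 < `|s - t| by rewrite normr_gt0 subr_eq0.
have -> : (F s - F t) / (s - t) - alpha * pr (busy M t) / (n * kappa) =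
    alpha / mu * (throughput M s - throughput M t - mu * (s - t) * pr (busy M t))
    / (n * kappa * (s - t)).
  rewrite mulrBr -eqF [kappa * n]mulrC; set k := n * kappa.
  have k0 : k != 0 by rewrite lt0r_neq0.
  have m0 : mu != 0 by rewrite lt0r_neq0.
  have st1 : s - t != 0 by rewrite subr_eq0.
  by field; rewrite k0 m0 st1.
rewrite normrM normfV normrM [`|alpha / mu|]gtr0_norm//.
rewrite [`|n * kappa * _|]normrM [`|n * kappa|]gtr0_norm//.
rewrite ler_pdivrMr ?mulr_gt0//.
apply: le_trans (ler_wpM2l (ltW alphamu_gt0) key) _.
have -> : C * (`|F s - F t| + `|s - t|) * (n * kappa * `|s - t|) =
   alpha / mu * (2 * mu * n) * `|s - t| *
   ((1 + N.+1%:R * mu) * (`|F s - F t| + `|s - t|)).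
  rewrite /C; set k := n * kappa.
  have k0 : k != 0 by rewrite lt0r_neq0.
  have m0 : mu != 0 by rewrite lt0r_neq0.
  by field; rewrite k0 m0.
have -> : alpha / mu *
    (2 * mu * n * `|s - t| * (`|F s - F t| + N.+1%:R * mu * `|s - t|)) =
  alpha / mu * (2 * mu * n) * `|s - t| * (`|F s - F t| + N.+1%:R * mu * `|s - t|).
  by rewrite !mulrA.
rewrite ler_wpM2l//; first by rewrite mulr_ge0.
have : 0 <= N.+1%:R * mu * `|F s - F t| by rewrite mulr_ge0.
by lra.
Qed.

Let supp_ex : exists t, cdf_support F t.
Proof.
have [x Fx] : exists x, F x < 2^-1 by apply: cdf_lt_ex; lra.
have [y Fy] : exists y, 2^-1 < F y by apply: cdf_gt_ex; lra.
by have [r [_ _ Fr _]] := quantile_in_support Fx (ltW Fy); exists r.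
Qed.

(** The wait until the opening alone costs - alpha * t, which bounds the support below by -
    ce/alpha. Were the support contained in t >= 0, arriving at - ce/(2 alpha) with nobody ahead
    would cost only ce/2. *)
Lemma first_arrival : early -> exists ta, [/\ ta < 0, cdf_support F ta &
  forall t, cdf_support F t -> ta <= t].
Proof.
move=> ee; pose S := cdf_support F.
have Sinf : has_inf S.
  split; first exact: supp_ex.
  exists (Num.min 0 (- (ce / alpha))) => t Ft; rewrite ge_min.
  have [//|t0] := leP 0 t; rewrite /=.
  rewrite lerNl ler_pdivlMr// -(cost_supp Ft) early_cost ?(ltW t0)//.
  have : 0 <= kappa * expected_ahead M t.
    apply: mulr_ge0; first exact: ltW.
    apply: le_trans (ahead_ge t); apply: mulr_ge0; first exact: ltW.
    exact: left_limit_ge0.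
  by lra.
exists (inf S); split; [|exact: cdf_support_inf|by move=> t; apply: ge_inf; case: Sinf].
rewrite ltNge; apply/negP => S0.
pose t := - (ce / (2 * alpha)); have ce0 := equilibrium_cost_gt0.
have t0 : t < 0 by rewrite oppr_lt0 divr_gt0// mulr_gt0.
have Ft : F t = 0.
  apply: cdf0_below => s st Fs; have := ge_inf Sinf.2 Fs; lra.
have adm : admissible early T t.
  by split; [rewrite ee|apply: le_trans (ltW T_gt0); rewrite lee_fin ltW].
have := cost_adm adm; rewrite early_cost ?(ltW t0)//.
rewrite aheadE ?ee// Ft mulr0 mulr0 addr0.
have -> : - alpha * t = ce / 2 by rewrite /t; field; rewrite lt0r_neq0.
by lra.
Qed.

(** Nobody leaves before the opening, so that the cost is affine in t and [F t]: the difference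
    quotient is exactly alpha / (n * kappa) and the error constant is 0. *)
Lemma density_early ta : early -> ta < 0 -> cdf_support F ta -> 0 < F 0 ->
  density_on `[ta, 0] F (fun=> alpha * mu / (n * (alpha + gamma * mu))).
Proof.
move=> ee ta0 Fta F0.
have et t : early || (0 < t) by rewrite ee.
have Ds t : `[ta, 0]%classic t -> cdf_support F t.
  rewrite /= in_itv/= => /andP[tat t0]; apply: (no_gap F0 Fta) => //.
  by apply: le_trans (ltW T_gt0); rewrite lee_fin.
apply: density_on_intro => [t _|t Dt]; first exact: F_continuous.
exists 0 => // s Dd st; rewrite mul0r.
have := cost_supp (Ds _ Dd); rewrite -(cost_supp (Ds _ Dt)).
move: Dd Dt; rewrite /= !in_itv/= => /andP[_ s0] /andP[_ t0].
rewrite !early_cost// !aheadE// => e.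
have k0 : 0 < n * kappa by exact: mulr_gt0.
have -> : F s - F t = alpha * (s - t) / (n * kappa).
  by apply: (mulfI (lt0r_neq0 k0)); rewrite mulrCA divff ?lt0r_neq0// mulr1; lra.
have g0 : 0 < alpha + gamma * mu by rewrite addr_gt0// mulr_gt0.
rewrite normr_le0; apply/eqP; field.
rewrite subr_eq0 st !lt0r_neq0//; lra.
Qed.

(** Without mass at 0, arriving at 0 would cost nothing, against [equilibrium_cost_gt0]. *)
Lemma atom_at_0 : ~~ early -> 0 < F 0 /\ cdf_support F 0.
Proof.
move=> ne; have Fneg t : t < 0 -> F t = 0.
  move=> t0; apply: cdf0_below => s st /supp_adm[+ _].
  by rewrite (negbTE ne) /=; lra.
have adm : admissible early T 0 by split; [rewrite lexx orbT|exact: ltW].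
have F0 : 0 < F 0.
  rewrite lt_neqAle cumulative_ge0 andbT eq_sym; apply/negP => /eqP F0.
  have := cost_adm adm; rewrite late_cost// throughput_le0// mulr0 subr0.
  have := ahead_le 0; rewrite F0 mulr0 => h.
  have : kappa * expected_ahead M 0 <= 0 by rewrite pmulr_rle0.
  by have := equilibrium_cost_gt0; lra.
split=> // e e0; rewrite Fneg; last by lra.
by apply: (lt_le_trans F0); apply: cdf_le; lra.
Qed.

(** Arriving just after 0 means being behind the whole atom, whereas at 0 tie-breaking spares a
    share of it. Departures need time to make up for this jump in cost, so that the support stays
    away from 0 on the right. *)
Lemma second_arrival : ~~ early -> F 0 < 1 -> exists te,
  [/\ 0 < te, (te%:E < T)%E, cdf_support F te &
      forall t, cdf_support F t -> 0 < t -> te <= t].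
Proof.
move=> ne F01; have [F0 supp0] := atom_at_0 ne.
have Fneg t : t < 0 -> F t = 0.
  move=> t0; apply: cdf0_below => s st /supp_adm[+ _].
  by rewrite (negbTE ne) /=; lra.
have l0 : left_limit F 0 = 0.
  apply/eqP; rewrite eq_le left_limit_ge0 andbT leNgt; apply/negP => h.
  have [s s0] := left_limit_adherent F 0 h.
  by rewrite subrr Fneg// ltxx.
pose S := cdf_support F `&` [set t | 0 < t].
have [y Fy] := cdf_gt_ex F F01.
have [r [r0 _ Fr _]] := quantile_in_support Fy (lexx _).
(* The jump is at least kappa * n * q * F 0, and departures lower the cost at rate at most alpha/mu
   * n * mu; [eta] is the quotient. *)
pose eta := kappa * q * F 0 / (alpha / mu * mu).
have am : 0 < alpha / mu * mu by exact: mulr_gt0.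
have eta0 : 0 < eta by apply: divr_gt0 => //; rewrite !mulr_gt0.
have Seta t : S t -> eta <= t.
  move=> [Ft /= t0]; rewrite leNgt; apply/negP => teta.
  have := cost_supp Ft; rewrite -(cost_supp supp0) !late_cost ?(ltW t0)//.
  rewrite (throughput_le0 M (lexx 0)) mulr0 subr0 => e.
  have /andP[_ h1] := expected_ahead_bounds M 0.
  have h2 := le_trans (ler_wpM2l (ltW n_gt0) (left_limit_ub F t0)) (ahead_ge t).
  have /andP[_ h3] := throughput_lip M mu_gt0 (ltW t0).
  rewrite l0 subr0 in h1; rewrite (throughput_le0 M (lexx 0)) !subr0 in h3.
  have h4 := ler_wpM2l (ltW kappa_gt0) h1.
  have h5 := ler_wpM2l (ltW kappa_gt0) h2.
  have h6 := ler_wpM2l (ltW alphamu_gt0) h3.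
  move: teta; rewrite /eta ltr_pdivlMr// => h7.
  have := h7; rewrite -(ltr_pM2l n_gt0) => h8.
  move: h4 h5 h6 e h8.
  set A0 := expected_ahead M 0; set At := expected_ahead M t.
  by lra.
have Sinf : has_inf S by split; [exists r|exists eta].
have Ste : cdf_support F (inf S) by apply: cdf_support_inf => // t [].
have te_eta : eta <= inf S by apply: lb_le_inf; [exists r|exact: Seta].
have te0 : 0 < inf S := lt_le_trans eta0 te_eta.
exists (inf S); split => //; last first.
  by move=> t Ft t0; apply: (ge_inf Sinf.2).
(* If the second arrival point were [T], all the mass 1 - F 0 would sit there as an atom, since [F]
   is constant on [0, T[. *)
rewrite lt_neqAle (supp_adm Ste).2 andbT; apply/negP => /eqP teT.
have Fte : F (inf S) = 1.
  apply/eqP; rewrite eq_le cumulative_le1 /= leNgt; apply/negP => h.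
  have [z zte] := cdf_gt_ex F h.
  have [p [pte _ Fp _]] := quantile_in_support zte (lexx _).
  by have := (supp_adm Fp).2; rewrite -teT lee_fin leNgt pte.
have := @no_atom (inf S); rewrite te0 orbT => /(_ isT); rewrite Fte => l1.
have d0 : 0 < 1 - F 0 by rewrite subr_gt0.
have [s ste] := left_limit_adherent F (inf S) d0; rewrite l1.
have [s0|s0] := leP s 0; first by have := cdf_le F s0; lra.
rewrite (@cdf_const _ F 0 s (ltW s0)); first by lra.
move=> x /andP[x0 xs] Fx; have Sx : S x by split.
by have := ge_inf Sinf.2 Sx; lra.
Qed.

End Equilibrium.

Unset Implicit Arguments.
Set Strict Implicit.
Set Printing Implicit Defensive.

Theorem theorem3p3 (R : realType) (N : nat) (alpha gamma mu : R)
    (T : \bar R) (early : bool)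
    (F : cumulativeBounded (0 : R) (1 : R))
    (d : measure_display) (Omega : measurableType d)
    (P : probability Omega R) (M : arrival_model N mu F P)
    (hN : (2 <= N)%N) (halpha : 0 < alpha) (hgamma : 0 < gamma)
    (hmu : 0 < mu) (hT : (0 < T)%E)
    (hsupp : tame_support F)
    (heq : symmetric_equilibrium alpha gamma early T M) :
  let f_after := fun t : R =>
    alpha * (1 - prob_empty M t) / (N%:R * (alpha / mu + gamma)) in
  (early ->
     (exists ta : R,
       [/\ ta < 0,
           cdf_support F ta,
           (forall t, cdf_support F t -> ta <= t) &
           density_on `[ta, 0] F
             (fun=> alpha * mu / (N%:R * (alpha + gamma * mu)))]) /\
     density_on [set t : R | 0 <= t /\ (t%:E < T)%E] F f_after) /\
  (~~ early -> F 0 < 1 ->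
     exists te : R,
       [/\ 0 < te,
           (te%:E < T)%E,
           cdf_support F `&` [set t | 0 < t] =
             [set t : R | te <= t /\ (t%:E <= T)%E] &
           density_on [set t : R | te <= t /\ (t%:E < T)%E] F f_after]).
Proof.
case: heq => supp_adm [ce [cost_supp cost_adm]].
have N_gt0 : (0 < N)%N by apply: leq_trans hN.
split=> [ee|ne F01].
  have [ta [ta0 Fta tamin]] :=
    first_arrival N_gt0 halpha hgamma hmu hT supp_adm cost_supp cost_adm ee.
  have F0 : 0 < F 0.
    have t0 : 0 < - ta by rewrite oppr_gt0.
    (* The support condition at [ta] with radius - ta has right end 0. *)
    have := Fta _ t0; rewrite subrr; apply: le_lt_trans; exact: cumulative_ge0.
  split.
    exists ta; split => //.
    exact: (density_early N_gt0 halpha hgamma hmu hT supp_adm cost_supp cost_adm).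
  apply: (density_late N_gt0 halpha hgamma hmu supp_adm cost_supp cost_adm).
  - move=> t [t0 /ltW tT].
    apply: (no_gap N_gt0 halpha hgamma hmu supp_adm cost_supp cost_adm F0 Fta) => //.
      by rewrite ee.
    exact: le_trans (ltW ta0) t0.
  - by move=> t [].
  - by rewrite ee.
have [te [te0 teT Fte temin]] :=
  second_arrival N_gt0 halpha hgamma hmu hT supp_adm cost_supp cost_adm ne F01.
have [F0 _] := atom_at_0 N_gt0 halpha hgamma hmu hT supp_adm cost_supp cost_adm ne.
have supp_te t : te <= t -> (t%:E <= T)%E -> cdf_support F t.
  apply: (no_gap N_gt0 halpha hgamma hmu supp_adm cost_supp cost_adm F0 Fte).
  by rewrite te0 orbT.
exists te; split => //.
  apply/seteqP; split => t /= [].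
    by move=> Ft t0; split; [exact: temin|exact: (supp_adm _ Ft).2].
  by move=> tet tT; split; [exact: supp_te|exact: lt_le_trans te0 tet].
apply: (density_late N_gt0 halpha hgamma hmu supp_adm cost_supp cost_adm).
- by move=> t [tet /ltW]; exact: supp_te.
- by move=> t [tet _]; exact: le_trans (ltW te0) tet.
- by move=> t [tet _]; rewrite (lt_le_trans te0 tet) orbT.
Qed.
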